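(* Let $p$ be an odd prime and let $\mathcal{W}$ be an intermediate subgroup in a diamond of the Nottingham group $\mathcal{N}$ over $\mathbb{F}_p$, i.e. $\mathcal{N}_{kp+3}<\mathcal{W}<\mathcal{N}_{kp+1}$ (strict inclusions) for some $k\ge 0$. Then: (i) If the diamond $\mathcal{N}_{kp+1}/\mathcal{N}_{kp+3}$ that contains $\mathcal{W}$ is not distinguished, then $\mathcal{N}/\mathcal{W}$ is a Beauville group. (ii) If the diamond that contains $\mathcal{W}$ is distinguished, say $\mathcal{N}_{z_m+1}<\mathcal{W}<\mathcal{N}_{z_m-1}$ with $m\ge 0$, then $\mathcal{N}/\mathcal{W}$ is a Beauville group if and only if the following two conditions hold: $m\ge 1$ if $p>3$, respectively $m\ge 2$ if $p=3$; and $\mathcal{W}\ne\mathcal{N}_{z_m}$ and $\mathcal{W}\ne\langle e,\mathcal{N}_{z_m+1}\rangle$, where $e\in\mathcal{N}$ is the automorphism given by $e(t)=t+t^{z_m}$.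
   Context: The Nottingham group $\mathcal{N}$ over $\mathbb{F}_p$ is the group, under composition, of normalised automorphisms of the ring $\mathbb{F}_p[[t]]$; each $f\in\mathcal{N}$ is completely determined by $f(t)=t+\sum_{i\ge 2}a_it^i$, with $a_i\in\mathbb{F}_p$ (all such series occur). For $k\ge 1$, $\mathcal{N}_k$ is the normal subgroup of all $f\in\mathcal{N}$ with $f(t)=t+\sum_{i\ge k+1}a_it^i$. The quotients $\mathcal{N}_{kp+1}/\mathcal{N}_{kp+3}$, $k\ge 0$, are called diamonds; they have order $p^2$, and all subgroups between $\mathcal{N}_{kp+3}$ and $\mathcal{N}_{kp+1}$ are normal in $\mathcal{N}$. Let $z_0=2$ and $z_m=p^m+p^{m-1}+\cdots+p+2$ for $m\ge 1$. The diamonds of the form $\mathcal{N}_{z_m-1}/\mathcal{N}_{z_m+1}$, $m\ge 0$, are called distinguished. For elements $x,y$ of a finite group $G$ let $\Sigma(x,y)=\bigcup_{g\in G}\big(\langle x\rangle^g\cup\langle y\rangle^g\cup\langle xy\rangle^g\big)$. A Beauville structure for $G$ is a pair of generating sets $\{x_1,y_1\}$, $\{x_2,y_2\}$ of $G$ such that $\Sigma(x_1,y_1)\cap\Sigma(x_2,y_2)=1$. $G$ is a Beauville group if it has a Beauville structure. *)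

(* Defs.v *)
From HB Require Import structures.
From mathcomp Require Import all_boot all_order all_algebra all_fingroup.
From mathcomp Require Import generic_quotient ring zify.
From mathcomp Require Import mathcomp_extra boolp classical_sets.

Set Implicit Arguments.
Unset Strict Implicit.
Unset Printing Implicit Defensive.

Import GRing.Theory.

Section Beauville.
Local Open Scope group_scope.
Variables (gT : finGroupType) (G : {group gT}).

Definition Sigma (x y : gT) : {set gT} :=
  \bigcup_(g in G) (<[x]> :^ g :|: <[y]> :^ g :|: <[x * y]> :^ g).

Definition beauville_structure (x1 y1 x2 y2 : gT) : Prop :=
  [/\ <<[set x1; y1]>> = G, <<[set x2; y2]>> = G
    & Sigma x1 y1 :&: Sigma x2 y2 = 1].

Definition is_beauville : Prop :=
  exists x1 y1 x2 y2 : gT, beauville_structure x1 y1 x2 y2.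

End Beauville.

Section Subgroups.
Local Open Scope group_scope.
Variable G : groupType.

Definition is_subgroup (H : set G) : Prop :=
  [/\ H 1, forall x y, H x -> H y -> H (x * y) & forall x, H x -> H x^-1].

Definition is_normal (H : set G) : Prop :=
  is_subgroup H /\ forall x y, H x -> H (x ^ y).

Definition finite_index (H : set G) : Prop :=
  exists s : seq G, forall x, exists2 y, y \in s & H (y^-1 * x).

Definition gen_subgroup (A : set G) : set G := smallest is_subgroup A.

End Subgroups.

Record fin_normal (G : groupType) := FinNormal {
  fn_set : set G;
  fn_normal : is_normal fn_set;
  fn_index : finite_index fn_set }.

Section Quotient.
Local Open Scope group_scope.
Local Open Scope quotient_scope.
Variables (G : groupType) (N : fin_normal G).
Local Notation H := (fn_set N).

Let H1 : H 1. Proof. by case: (fn_normal N) => -[]. Qed.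
Let HM x y : H x -> H y -> H (x * y).
Proof. by case: (fn_normal N) => -[_ h _] _; apply: h. Qed.
Let HV x : H x -> H x^-1.
Proof. by case: (fn_normal N) => -[_ _ h] _; apply: h. Qed.
Let HJ x y : H x -> H (x ^ y).
Proof. by case: (fn_normal N) => _; apply. Qed.

Definition coset_rel : rel G := fun x y => `[< H (x^-1 * y) >].

Lemma coset_rel_refl : reflexive coset_rel.
Proof. by move=> x; apply/asboolP; rewrite mulVg. Qed.

Lemma coset_rel_sym : symmetric coset_rel.
Proof.
by move=> x y; apply/asboolP/asboolP => /HV; rewrite invgM invgK.
Qed.

Lemma coset_rel_trans : transitive coset_rel.
Proof.
move=> y x z /asboolP xy /asboolP yz; apply/asboolP.
by move: (HM xy yz); rewrite mulgA mulgK.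
Qed.

Canonical coset_equiv :=
  EquivRel coset_rel coset_rel_refl coset_rel_sym coset_rel_trans.

Definition quot : Type := {eq_quot coset_equiv}.
HB.instance Definition _ := Choice.on quot.
HB.instance Definition _ := Quotient.on quot.

Lemma quotP (x y : G) : (\pi_quot x = \pi_quot y) <-> H (x^-1 * y).
Proof.
by split=> [/eqmodP/asboolP//|h]; apply/eqmodP/asboolP.
Qed.

Let reprP (x : G) : H ((repr (\pi_quot x))^-1 * x).
Proof. by apply/quotP; rewrite reprK. Qed.

Definition quot_mul (a b : quot) : quot := \pi_quot (repr a * repr b).
Definition quot_one : quot := \pi_quot 1.
Definition quot_inv (a : quot) : quot := \pi_quot (repr a)^-1.

Lemma pi_quotM (x y : G) :
  \pi_quot (x * y) = quot_mul (\pi_quot x) (\pi_quot y).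
Proof.
apply/esym/quotP; set u := repr _; set v := repr _.
have -> : (u * v)^-1 * (x * y) = (u^-1 * x) ^ v * (v^-1 * y).
  by rewrite /conjg invgM !mulgA !mulgK.
by apply: HM; [apply: HJ|]; apply: reprP.
Qed.

Lemma pi_quotV (x : G) : \pi_quot x^-1 = quot_inv (\pi_quot x).
Proof.
apply/quotP; set u := repr _; rewrite invgK.
have -> : x * u^-1 = (u^-1 * x) ^ u^-1 by rewrite /conjg invgK !mulgA mulgV mul1g.
exact/HJ/reprP.
Qed.

Lemma quot_mulA : associative quot_mul.
Proof.
move=> a b c; rewrite -[a]reprK -[b]reprK -[c]reprK.
by move: (repr a) (repr b) (repr c) => x y z; rewrite -(pi_quotM x y) -(pi_quotM y z) -!pi_quotM mulgA.
Qed.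

Lemma quot_mul1g : left_id quot_one quot_mul.
Proof. by move=> a; rewrite -[a]reprK; move: (repr a) => x; rewrite -pi_quotM mul1g. Qed.

Lemma quot_mulg1 : right_id quot_one quot_mul.
Proof. by move=> a; rewrite -[a]reprK; move: (repr a) => x; rewrite -pi_quotM mulg1. Qed.

Lemma quot_mulVg : left_inverse quot_one quot_inv quot_mul.
Proof. by move=> a; rewrite -[a]reprK; move: (repr a) => x; rewrite -pi_quotV -pi_quotM mulVg. Qed.

Lemma quot_mulgV : right_inverse quot_one quot_inv quot_mul.
Proof. by move=> a; rewrite -[a]reprK; move: (repr a) => x; rewrite -pi_quotV -pi_quotM mulgV. Qed.

HB.instance Definition _ := isGroup.Build quot
  quot_mulA quot_mul1g quot_mulg1 quot_mulVg quot_mulgV.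

Definition quot_enum : seq quot :=
  undup [seq \pi_quot x | x <- projT1 (cid (fn_index N))].

Lemma mem_quot_enum a : a \in quot_enum.
Proof.
rewrite mem_undup; apply/mapP; case: (cid _) => s /= /(_ (repr a))[y ys Hy].
by exists y => //; rewrite -[a]reprK; apply/esym/quotP.
Qed.

Lemma quot_enumP : Finite.axiom quot_enum.
Proof.
by move=> a; rewrite count_uniq_mem ?undup_uniq// mem_quot_enum.
Qed.

Lemma quot_pickleK :
  pcancel (index^~ quot_enum) (nth None [seq Some a | a <- quot_enum]).
Proof.
by move=> a; rewrite (nth_map a) ?index_mem ?mem_quot_enum// nth_index//
  mem_quot_enum.
Qed.

HB.instance Definition _ := isCountable.Build quot quot_pickleK.
HB.instance Definition _ := isFinite.Build quot quot_enumP.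

End Quotient.

Section Series.
Local Open Scope ring_scope.
Variable R : comNzRingType.
Implicit Types (P Q D : {poly R}) (f g h : nat -> R).

Definition trunc (n : nat) f : {poly R} := \poly_(i < n.+1) f i.

(* The series [f (g (t))], for [g] without constant term: the coefficient of *)
(* [t^n] then only depends on the terms of degree at most [n] of [f], [g].   *)
Definition scomp f g : nat -> R := fun n => (trunc n f \Po trunc n g)`_n.

Definition eqX (m : nat) P Q : Prop := exists D, P = Q + 'X^m * D.

Lemma eqX_refl m P : eqX m P P.
Proof. by exists 0; rewrite mulr0 addr0. Qed.

Lemma eqX_sym m P Q : eqX m P Q -> eqX m Q P.
Proof. by case=> D ->; exists (- D); ring. Qed.

Lemma eqX_trans m Q P P' : eqX m P Q -> eqX m Q P' -> eqX m P P'.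
Proof. by case=> D -> [E ->]; exists (D + E); ring. Qed.

Lemma eqX_add m P P' Q Q' : eqX m P P' -> eqX m Q Q' -> eqX m (P + Q) (P' + Q').
Proof. by case=> D -> [E ->]; exists (D + E); ring. Qed.

Lemma eqX_mul m P P' Q Q' : eqX m P P' -> eqX m Q Q' -> eqX m (P * Q) (P' * Q').
Proof.
by case=> D -> [E ->]; exists (P' * E + D * Q' + 'X^m * D * E); ring.
Qed.

Lemma eqX_le m n P Q : (m <= n)%N -> eqX n P Q -> eqX m P Q.
Proof.
by move=> mn [D ->]; exists ('X^(n - m) * D); rewrite mulrA -exprD subnKC.
Qed.

Lemma eqX_coef m P Q i : eqX m P Q -> (i < m)%N -> P`_i = Q`_i.
Proof. by case=> D -> im; rewrite coefD coefXnM im addr0. Qed.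

Lemma coef_eqX m P Q : (forall i, (i < m)%N -> P`_i = Q`_i) -> eqX m P Q.
Proof.
move=> eqPQ; exists (drop_poly m (P - Q)).
rewrite mulrC -[P in LHS](subrK Q) addrC; congr (_ + _).
rewrite -[LHS](poly_take_drop m) [take_poly _ _](_ : _ = 0) ?add0r//.
apply/polyP => i; rewrite coef_take_poly coef0; case: ifP => // im.
by rewrite coefB eqPQ// subrr.
Qed.

Lemma eqX_comp m P P' Q Q' : Q`_0 = 0 ->
  eqX m P P' -> eqX m Q Q' -> eqX m (P \Po Q) (P' \Po Q').
Proof.
move=> Q0 eqP eqQ; apply: (@eqX_trans _ (P' \Po Q)).
  have [S QE] : exists S, Q = 'X * S.
    have /coef_eqX[S] : forall i, (i < 1)%N -> Q`_i = (0 : {poly R})`_i.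
      by case=> // _; rewrite coef0 Q0.
    by rewrite add0r expr1 => ->; exists S.
  case: eqP => D ->; exists (S ^+ m * (D \Po Q)).
  by rewrite comp_polyD comp_polyM comp_Xn_poly {2}QE exprMn mulrA.
elim/poly_ind: P' {eqP} => [|P' c IH]; first by rewrite !comp_poly0; exact: eqX_refl.
rewrite !comp_poly_MXaddC; apply: eqX_add (eqX_refl _ _).
exact: eqX_mul.
Qed.

Lemma coef_trunc n f i : (i <= n)%N -> (trunc n f)`_i = f i.
Proof. by move=> im; rewrite coef_poly ltnS im. Qed.

Lemma eqX_trunc m n f : (m <= n)%N -> eqX m.+1 (trunc n f) (trunc m f).
Proof.
by move=> mn; apply: coef_eqX => i im; rewrite !coef_trunc//; lia.
Qed.

Lemma trunc_scomp n f g : g 0%N = 0 ->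
  eqX n.+1 (trunc n (scomp f g)) (trunc n f \Po trunc n g).
Proof.
move=> g0; apply: coef_eqX => i; rewrite ltnS => im; rewrite coef_trunc//.
apply/esym; apply: (@eqX_coef i.+1) => //.
by apply: eqX_comp; rewrite ?coef_trunc//; apply: eqX_trunc.
Qed.

Lemma scomp0 f g : f 0%N = 0 -> scomp f g 0%N = 0.
Proof.
move=> f0; rewrite /scomp [trunc 0 f](_ : _ = 0) ?comp_poly0 ?coef0//.
by apply/polyP => -[|i]; rewrite coef0 coef_poly.
Qed.

Lemma scompA f g h : g 0%N = 0 -> h 0%N = 0 ->
  scomp f (scomp g h) = scomp (scomp f g) h.
Proof.
move=> g0 h0; apply/funext => n; apply: (@eqX_coef n.+1) => //.
have trh : (trunc n h)`_0 = 0 by rewrite coef_trunc.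
have trg : (trunc n g)`_0 = 0 by rewrite coef_trunc.
apply: (@eqX_trans _ (trunc n f \Po (trunc n g \Po trunc n h))).
  by apply: eqX_comp; rewrite ?coef_trunc ?scomp0//;
    [exact: eqX_refl | exact: trunc_scomp].
rewrite comp_polyA; apply: eqX_sym; apply: eqX_comp => //.
  exact: trunc_scomp.
exact: eqX_refl.
Qed.

Definition sid : nat -> R := fun i => (i == 1%N)%:R.

Lemma trunc_sid n : eqX n.+1 (trunc n sid) 'X.
Proof. by apply: coef_eqX => i im; rewrite coef_trunc// coefX. Qed.

Lemma scomp_idl g : g 0%N = 0 -> scomp sid g = g.
Proof.
move=> g0; apply/funext => n; rewrite -[RHS](coef_trunc g (leqnn n)).
apply: (@eqX_coef n.+1) => //; rewrite -[X in eqX _ _ X]comp_polyX.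
by apply: eqX_comp; rewrite ?coef_trunc//; [exact: trunc_sid|exact: eqX_refl].
Qed.

Lemma scomp_idr f : scomp f sid = f.
Proof.
apply/funext => n; rewrite -[RHS](coef_trunc f (leqnn n)).
apply: (@eqX_coef n.+1) => //; rewrite -[X in eqX _ _ X]comp_polyXr.
by apply: eqX_comp; rewrite ?coef_trunc//; [exact: eqX_refl|exact: trunc_sid].
Qed.

Lemma trunc_factor n f : f 0%N = 0 -> f 1%N = 1 -> (0 < n)%N ->
  exists S, trunc n f = 'X * (1 + 'X * S).
Proof.
move=> f0 f1 n0.
have [S ->] : eqX 2 (trunc n f) 'X.
  by apply: coef_eqX => -[|[|i]]// _; rewrite coef_trunc// coefX.
by exists S; ring.
Qed.

(* The left inverse of [f], one coefficient at a time: [linv_poly f n]       *)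
(* collects the terms of degree less than [n].                               *)
Fixpoint linv_poly f n : {poly R} :=
  if n is m.+1 then
    linv_poly f m + (sid m - (linv_poly f m \Po trunc m f)`_m) *: 'X^m
  else 0.

Definition linv f : nat -> R := fun n => (linv_poly f n.+1)`_n.

Lemma coef_linv_poly f n i : (linv_poly f n)`_i = if (i < n)%N then linv f i else 0.
Proof.
elim: n i => [|n IH] i; first by rewrite coef0.
rewrite /= coefD IH coefZ coefXn ltnS (leq_eqVlt i n).
have [->|ni] := eqVneq i n; last by rewrite mulr0 addr0.
by rewrite ltnn add0r mulr1 /linv /= coefD IH ltnn add0r coefZ coefXn eqxx mulr1.
Qed.

Lemma trunc_linv f n : trunc n (linv f) = linv_poly f n.+1.
Proof. by apply/polyP => i; rewrite coef_linv_poly coef_poly. Qed.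

Lemma linvP f : f 0%N = 0 -> f 1%N = 1 -> scomp (linv f) f = sid.
Proof.
move=> f0 f1; apply/funext => n; rewrite /scomp trunc_linv /=.
rewrite comp_polyD comp_polyZ comp_Xn_poly coefD coefZ.
suff -> : (trunc n f ^+ n)`_n = 1 by rewrite mulr1 addrC subrK.
case: n => [|n]; first by rewrite expr0 coef1.
have [S ->] := trunc_factor f0 f1 (ltn0Sn n).
rewrite exprMn coefXnM ltnn subnn -[RHS](@coef1 R 0).
apply: (@eqX_coef 1) => //; rewrite -[X in eqX _ _ X](expr1n _ n.+1).
elim: n.+1 => [|k IH]; first exact: eqX_refl.
by rewrite !exprS; apply: (eqX_mul _ IH); exists S.
Qed.

Lemma linv0 f : linv f 0%N = 0.
Proof. by rewrite /linv /= comp_poly0 coef0 subr0 /sid scale0r add0r coef0. Qed.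

Lemma scomp1 f g : f 0%N = 0 -> g 0%N = 0 -> scomp f g 1%N = f 1%N * g 1%N.
Proof.
move=> f0 g0; have tr1 h : h 0%N = 0 -> trunc 1 h = h 1%N *: 'X.
  move=> h0; apply/polyP => i; rewrite coef_poly coefZ coefX.
  by case: i => [|[|i]] //=; rewrite ?mulr0 ?mulr1.
by rewrite /scomp !tr1// comp_polyZ comp_polyX !coefZ coefX mulr1.
Qed.

Lemma linv1 f : f 0%N = 0 -> f 1%N = 1 -> linv f 1%N = 1.
Proof.
move=> f0 f1; have := congr1 (@^~ 1%N) (linvP f0 f1).
by rewrite scomp1 ?linv0// f1 mulr1.
Qed.

Lemma scomp_comm (K : nat) f g : (0 < K)%N -> (K.-1%:R = 0 :> R) ->
  f 0%N = 0 -> f 1%N = 1 -> g 0%N = 0 -> g 1%N = 1 ->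
  (forall i, (2 <= i <= K)%N -> f i = 0) ->
  eqX K.+3 (trunc K.+2 f \Po trunc K.+2 g) (trunc K.+2 g \Po trunc K.+2 f).
Proof.
move=> K0 KR f0 f1 g0 g1 fK.
set F := trunc _ f; set G := trunc _ g.
have G0 : G`_0 = 0 by rewrite coef_trunc.
have F0 : F`_0 = 0 by rewrite coef_trunc.
pose a := f K.+1; pose a' := f K.+2; pose b := g 2%N.
have FE : F = 'X + a *: 'X^(K.+1) + a' *: 'X^(K.+2).
  apply/polyP => i; rewrite !coefD !coefZ !coefXn coefX.
  have [iK|iK] := leqP i K.+2; last first.
    rewrite coef_poly ltnS leqNgt iK /=.
    have -> : (i == 1%N) = false by lia.
    have -> : (i == K.+1) = false by lia.
    have -> : (i == K.+2) = false by lia.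
    by rewrite !mulr0 !addr0.
  rewrite coef_trunc//; case: (ltngtP i K.+1) => iK1.
  - have -> : (i == K.+2) = false by lia.
    rewrite !mulr0 !addr0.
    by case: i iK iK1 => [|[|i]]// _ ?; rewrite fK//; lia.
  - have -> : i = K.+2 by lia.
    have -> : (K.+2 == 1%N) = false by lia.
    by rewrite eqxx !mulr0 !mulr1 !add0r.
  - have -> : (i == 1%N) = false by lia.
    have -> : (i == K.+2) = false by lia.
    by rewrite iK1 mulr1 mulr0 addr0 add0r.
have [S GS] : exists S, G = 'X * (1 + 'X * (b%:P + 'X * S)).
  have [S ->] : eqX 3 G ('X + b *: 'X^2).
    apply: coef_eqX => -[|[|[|i]]]// _;
      by rewrite coefD coefZ coefXn coefX coef_trunc//= ?g0 ?g1 ?mulr0 ?mulr1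
         ?addr0 ?add0r.
  by exists S; rewrite -mul_polyC; ring.
set T := b%:P + 'X * S in GS.
have GX : G = 'X + 'X^2 * T by rewrite GS; ring.
have powG n : exists E, G ^+ n = 'X^n * (1 + n%:R * 'X * T + 'X^2 * E).
  elim: n => [|n [E EE]]; first by exists 0; rewrite !expr0; ring.
  exists (n%:R * T ^+ 2 + E * (1 + 'X * T)).
  by rewrite exprS EE GS [in RHS]exprS -natr1; ring.
pose M := G + a *: ('X^(K.+1) + (b *+ 2) *: 'X^(K.+2)) + a' *: 'X^(K.+2).
have KP : K.-1%:R = 0 :> {poly R} by rewrite -polyC_natr KR.
apply: (@eqX_trans _ M).
  rewrite FE !comp_polyD !comp_polyZ comp_polyX !comp_Xn_poly.
  have [E1 ->] := powG K.+1; have [E2 ->] := powG K.+2.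
  exists (a *: (2%:R * S + E1) + a' *: (K.+2%:R * T + 'X * E2)).
  have K1E : K.+1%:R = 2%:R :> {poly R}.
    by rewrite -(prednK K0) -addn2 natrD KP add0r.
  rewrite K1E /M -!mul_polyC /T polyCMn !exprS; ring.
apply: eqX_sym; rewrite {}/M -!mul_polyC polyCMn.
have GE : G = 'X + b%:P * 'X^2 + 'X^3 * S by rewrite GX /T; ring.
have [D SD] : eqX K.+1 (S \Po F) S.
  rewrite -[X in eqX _ _ X]comp_polyXr; apply: eqX_comp => //; first exact: eqX_refl.
  by exists (a%:P + a'%:P * 'X); rewrite FE -!mul_polyC !exprS; ring.
rewrite [G in G \Po _]GE !comp_polyD (comp_polyM b%:P) (comp_polyM 'X^3).
rewrite !comp_Xn_poly comp_polyX comp_polyC.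
rewrite SD FE -!mul_polyC GE -[K](prednK K0) !exprS expr0.
set Y := 'X ^+ _; set A := a%:P; set A' := a'%:P; set B := b%:P.
pose U := A + A' * 'X.
exists (2%:R * B * A' + B * Y * U ^+ 2
  + (3%:R * U + 3%:R * 'X * Y * U ^+ 2 + 'X ^+ 2 * Y ^+ 2 * U ^+ 3) * S
  + 'X * (1 + 'X * Y * U) ^+ 3 * D).
by rewrite /U -[K.-1.+4]addn4 exprD -/Y; ring.
Qed.

End Series.

(* An automorphism [f] is represented by the coefficients of the series      *)
(* [f(t) = t + a_2 t^2 + ...]. The type is meant for prime [p] only.         *)
Record nottingham (p : nat) := Nottingham {
  ncoef :> nat -> 'F_p;
  ncoefP : (ncoef 0%N == 0%R) && (ncoef 1%N == 1%R) }.

HB.instance Definition _ p := [isSub for @ncoef p].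
HB.instance Definition _ p := [Choice of nottingham p by <:].

Section Nottingham.
Local Open Scope ring_scope.
Variable p : nat.
Implicit Types f g h : nottingham p.

Lemma ncoef0 f : f 0%N = 0. Proof. by case/andP: (ncoefP f) => /eqP. Qed.
Lemma ncoef1 f : f 1%N = 1. Proof. by case/andP: (ncoefP f) => _ /eqP. Qed.

Lemma nott_ext f g : (forall i, f i = g i) -> f = g.
Proof. by move=> fg; apply: val_inj; apply/funext. Qed.

Fact nott_mul_subproof f g :
  (scomp f g 0%N == 0) && (scomp f g 1%N == 1).
Proof. by rewrite scomp0 ?scomp1 ?ncoef0// !ncoef1 mulr1 !eqxx. Qed.

(* [(f * g)(t) = f(g(t))]: this is composition of the automorphisms written  *)
(* on the right, i.e. first [f], then [g].                                   *)
Definition nott_mul f g := Nottingham (nott_mul_subproof f g).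

Fact nott_one_subproof : (sid 'F_p 0%N == 0) && (sid 'F_p 1%N == 1).
Proof. by rewrite /sid !eqxx. Qed.

Definition nott_one := Nottingham nott_one_subproof.

Fact nott_inv_subproof f : (linv f 0%N == 0) && (linv f 1%N == 1).
Proof. by rewrite linv0 linv1 ?ncoef0 ?ncoef1 ?eqxx. Qed.

Definition nott_inv f := Nottingham (nott_inv_subproof f).

Lemma nott_mulA : associative nott_mul.
Proof. by move=> f g h; apply: val_inj; rewrite /= scompA ?ncoef0. Qed.

Lemma nott_mul1g : left_id nott_one nott_mul.
Proof. by move=> f; apply: val_inj; rewrite /= scomp_idl ?ncoef0. Qed.

Lemma nott_mulg1 : right_id nott_one nott_mul.
Proof. by move=> f; apply: val_inj; rewrite /= scomp_idr. Qed.

Lemma nott_mulVg : left_inverse nott_one nott_inv nott_mul.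
Proof. by move=> f; apply: val_inj; rewrite /= linvP ?ncoef0 ?ncoef1. Qed.

Lemma nott_mulgV : right_inverse nott_one nott_inv nott_mul.
Proof.
move=> f; set g := nott_inv f.
rewrite -[LHS]nott_mul1g -[in LHS](nott_mulVg g) -nott_mulA.
by rewrite [nott_mul g _]nott_mulA nott_mulVg nott_mul1g nott_mulVg.
Qed.

HB.instance Definition _ := isGroup.Build (nottingham p)
  nott_mulA nott_mul1g nott_mulg1 nott_mulVg nott_mulgV.

Lemma nott_mulE f g i : (f * g)%g i = scomp f g i. Proof. by []. Qed.

(* N_k is the subgroup of the [f] with [f(t) = t + a_(k+1) t^(k+1) + ...], so *)
(* coefficient [k] itself vanishes; only [k >= 1] is meaningful.             *)
Definition nott_sub (k : nat) : set (nottingham p) :=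
  fun f => forall i, (2 <= i <= k)%N -> f i = 0.

Lemma nott_sub_div n f g :
  (forall i, (i <= n)%N -> f i = g i) -> nott_sub n (f^-1 * g)%g.
Proof.
move=> fg i /andP[i2 im]; have : (f^-1 * f)%g i = 0.
  by rewrite mulVg /= /sid; case: i i2 {im} => [|[|i]].
rewrite !nott_mulE => <-; rewrite /scomp; congr (_ \Po _)`_i.
by apply/polyP => j; rewrite !coef_poly; case: ifP => // ji; rewrite fg//; lia.
Qed.

End Nottingham.

Lemma diamond_normal (p k : nat) (W : set (nottingham p)) :
  prime p -> is_subgroup W ->
  (nott_sub (k * p + 3) `<` W)%classic -> (W `<` nott_sub (k * p + 1))%classic ->
  is_normal W.
Proof.
move=> p_pr gW [subW _] [Wsub _]; split=> // w g Ww.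
have [_ WM _] := gW.
have -> : (w ^ g = w * ((g * w)^-1 * (w * g)))%g.
  by rewrite /conjg invgM !mulgA mulgV mul1g.
apply: WM => //; apply: subW; apply: nott_sub_div => i iK.
have [D ED] : eqX (k * p).+4 (trunc (k * p).+3 w \Po trunc (k * p).+3 g)
    (trunc (k * p).+3 g \Po trunc (k * p).+3 w).
  apply: (@scomp_comm _ (k * p).+1); rewrite ?ncoef0 ?ncoef1//.
    by rewrite natrM [p%:R%R]pchar_Fp_0// mulr0.
  move=> m mK; apply: (Wsub _ Ww). by rewrite addn1.
have trE (f h : nottingham p) :
    ((trunc (k * p).+3 f \Po trunc (k * p).+3 h)`_i)%R = (f * h)%g i.
  rewrite nott_mulE /scomp; apply: (@eqX_coef _ i.+1) => //.
  have im : (i <= (k * p).+3)%N by lia.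
  apply: eqX_comp; rewrite ?coef_trunc ?ncoef0//; exact: eqX_trunc.
rewrite -!trE; apply/esym/(@eqX_coef _ (k * p).+4); last by lia.
by exists D.
Qed.

Lemma diamond_index (p k : nat) (W : set (nottingham p)) :
  (nott_sub (k * p + 3) `<` W)%classic -> finite_index W.
Proof.
move=> [subW _]; set n := (k * p + 3)%N in subW *.
pose c (v : {ffun 'I_n.+1 -> 'F_p}) (i : nat) : 'F_p :=
  (if (1 < i <= n)%N then v (inord i) else (i == 1%N)%:R)%R.
have cP v : ((c v 0%N == 0) && (c v 1%N == 1))%R by rewrite /c /= !eqxx.
exists [seq Nottingham (cP v) | v <- enum {: {ffun 'I_n.+1 -> 'F_p}}] => x.
exists (Nottingham (cP [ffun i : 'I_n.+1 => x i])).
  by apply: map_f; rewrite mem_enum.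
apply: subW; apply: nott_sub_div => i im /=; rewrite /c im andbT.
case: i im => [|[|i]] im /=; rewrite ?ncoef0 ?ncoef1//.
by rewrite ffunE inordK.
Qed.

(* [N/W] for an intermediate subgroup [W] of a diamond, as a finite group:   *)
(* such a [W] is normal and of finite index.                                 *)
Definition diamond_quot (p k : nat) (W : set (nottingham p)) (p_pr : prime p)
    (gW : is_subgroup W)
    (ltW : (nott_sub (k * p + 3) `<` W)%classic)
    (Wlt : (W `<` nott_sub (k * p + 1))%classic) : finGroupType :=
  quot (FinNormal (diamond_normal p_pr gW ltW Wlt) (diamond_index ltW)).

(* z_m = p^m + ... + p + 2, with z_0 = 2 (empty sum). *)
Definition zdist (p m : nat) : nat := \sum_(1 <= i < m.+1) p ^ i + 2.

(* The diamond N_(kp+1)/N_(kp+3) is N_(z_m - 1)/N_(z_m + 1). *)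
Definition diamond_at (p k m : nat) : Prop :=
  (k * p + 1 = zdist p m - 1)%N /\ (k * p + 3 = zdist p m + 1)%N.

Definition distinguished (p k : nat) : Prop := exists m, diamond_at p k m.

Definition special_series (p m : nat) : nat -> 'F_p :=
  (fun i => (i == 1%N)%:R + (i == zdist p m)%:R)%R.

Fact special_elt_subproof (p m : nat) :
  ((special_series p m 0%N == 0) && (special_series p m 1%N == 1))%R.
Proof.
rewrite /special_series /zdist addn2.
by apply/andP; split; apply/eqP; apply: addr0.
Qed.

Definition special_elt (p m : nat) : nottingham p :=
  Nottingham (special_elt_subproof p m).

(* Main.v *)
Require Import Defs.
From HB Require Import structures.
From mathcomp Require Import all_boot all_order all_algebra all_fingroup.
From mathcomp Require Import generic_quotient ring zify.
From mathcomp Require Import boolp classical_sets.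

Set Implicit Arguments.
Unset Strict Implicit.
Unset Printing Implicit Defensive.

Import GRing.Theory.

(** Write N_d for the elements [t + O(t^(d+1))]. For d = 1 mod p the quotient
    N_d/N_(d+2) is central in N/N_(d+2) and is a plane over F_p; [coord1] and
    [coord2] are linear coordinates on it, and every line of the plane is an
    intermediate subgroup of the diamond. For d = 1 this plane is N/N_3, the
    Frattini quotient of every N/W with W contained in N_3, so that generating
    pairs are the pairs with independent images ([generate_indep]), and the
    lines of N/N_3 are the maximal subgroups. Call the ratio
    [coord2 / coord1] of a line its slope.

    The proof rests on a link between the slopes of different diamonds. If g
    lies in N_d, d = 1 mod p, with coordinates (A, B), then g^p has depth at
    least pd+1, and its coefficient there is -A^(p-1) B ([exp_p_depth]); this
    is read off the p-th power of the operator h |-> h o g - h, which in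
    characteristic p is h |-> h o g^p - h. On the other hand, an element of a
    diamond with d > 1 that commutes with some f of depth 1 has the slope of f
    ([centralizer_slope]). So if the slope c of f is neither 0 nor infinite,
    then f^(p^l) has depth exactly z_l - 1, and slope c again, for every l
    ([slope_exp]): the distinguished diamonds are those where the powers of the
    elements of depth 1 live. For the slopes 0 and infinity there are elements
    t (1 - d t^d)^(-1/d), with d = 1 and d = 2, of order p
    ([exists_order_p]).

    Existence. Let T and S be such elements of order p, and let s be the slope
    of W if the diamond of W is distinguished, any nonzero number otherwise.
    The first generating pair is T, S^s, with product of slope s. An element of
    these three cyclic groups that is trivial modulo N_(kp+1) is then trivial
    modulo W, so that only congruences modulo N_(kp+1) matter. For p > 3 the
    second pair consists of elements with slopes -s and 2s, and product of
    slope s/2; elements of slopes that differ generate subgroups that do not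
    meet up to conjugacy ([separated_slope], [separated_order_p]). For p = 3
    there are only four slopes, so that 0 and infinity must be used again. The
    second pair is T u, (S v)^(-s), where u and v are deep but chosen such that
    (T u)^3 and (S v)^3 are nontrivial modulo N_(kp+3). Thus no conjugate of T
    is congruent to T u modulo N_(kp+1), which separates the cyclic groups of
    the same slope ([separated_perturb]).

    Non-existence, in the diamond of z_m. If W has slope 0 or infinity, each
    generating triple x, y, xy contains an element of another slope, and its
    p^m-th power generates the group N_(kp+1)/W of order p, which is thus met
    by both triples ([not_beauville_axis]). If m = 0 the group N/W itself has
    order p. If p = 3, m = 1 and W has slope s, the elements of slope -s all
    have cubes that generate N_4/W, and for every other slope the elements with
    given image in N/N_3 form one conjugacy class of N/W ([conj_class_mod]);
    among four slopes two triples cannot avoid both obstructions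
    ([not_beauville_3_1]). *)

(** * Composition of expansions to second order *)

Section Expansion.
Local Open Scope ring_scope.

(** The term quadratic in [A] has order [2 K] relative to [t ^+ n]; to the
    precision kept here it matters only if [K = 1]. *)
Lemma expand_exp (R : comNzRingType) (t A B S : R) (K n : nat) : (0 < K)%N ->
  exists E, (t * (1 + t ^+ K * (A + B * t + t ^+ 2 * S))) ^+ n =
    t ^+ n * (1 + t ^+ K * (A *+ n
      + (B *+ n + (A ^+ 2 *+ 'C(n, 2)) *+ (K == 1%N)) * t + t ^+ 2 * E)).
Proof.
move=> K0; elim: n => [|n [F IH]].
  by exists 0; rewrite !mulr0n mul0rn; ring.
rewrite exprSr {}IH.
rewrite binS bin1 (mulrSr A) (mulrSr B) mulrnDr -[A *+ n]mulr_natr -[B *+ n]mulr_natr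
  -[A ^+ 2 *+ n]mulr_natr -[_ *+ 'C(n, 2)]mulr_natr.
move: n%:R 'C(n, 2)%:R => u v.
case: K K0 => [//|[|K]] _.
  rewrite eqxx !mulr1n !expr1.
  pose q := A + B * t + t ^+ 2 * S.
  exists (F + S + A * u * (B + t * S) + (B * u + A ^+ 2 * v) * q + t * F * q).
  by rewrite /q [t ^+ n.+1]exprSr; ring.
rewrite [K.+2 == 1%N]/= !mulr0n !addr0.
pose q := A + B * t + t ^+ 2 * S.
exists (F + S + t ^+ K * ((A * u + B * u * t + t ^+ 2 * F) * q)).
rewrite /q [t ^+ n.+1]exprSr [t ^+ K.+2]exprS [t ^+ K.+1]exprS.
move: (t ^+ n) (t ^+ K) => x y; ring.
Qed.

(** The polynomial identity behind [comp_expand]: [t * v], [c0], [c1], [E]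
    describe a power of [t + t * Y * q], and [D] the effect of the
    substitution on the tail [S]. *)
Lemma comp_expand_ring (A : comNzRingType)
    (u v t a a' b b' c0 c1 S T D E : A) :
  exists Z, let q := b + b' * t + t ^+ 2 * T in let Y := t * v in
    (t + t * Y * q)
      + u * (1 + Y * (c0 + c1 * t + t ^+ 2 * E))
        * (a + a' * (t + t * Y * q) + (t + t * Y * q) ^+ 2 * (S + t * Y * D))
    = t + u * (a + a' * t + t ^+ 2 * S) + t * Y * q
      + u * Y * (a * c0 + (a * c1 + a' * (c0 + b)) * t)
      + u * Y * t ^+ 2 * Z.
Proof.
set q := b + _ + _; set Y := t * v.
pose M2 := (2%:R * q + Y * q ^+ 2) * (S + t * Y * D) + t * D.
pose r := S + a' * v * q + Y * M2; pose r1 := a' + t * r.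
pose M := a + t * r1.
exists (a' * (b' + t * T) + M2 + c0 * r + c1 * r1 + E * M) => /=.
have -> : a + a' * (t + t * Y * q) + (t + t * Y * q) ^+ 2 * (S + t * Y * D) = M.
  by rewrite /M /r1 /r /M2 /Y; ring.
have Mq : M = a + a' * t + t ^+ 2 * S + Y * (a' * b * t + t ^+ 2 * (a' * (b' + t * T) + M2)).
  by rewrite /M /r1 /r /Y /q; ring.
transitivity (t + t * Y * q + u * M + u * Y * (c0 * M + c1 * t * M + t ^+ 2 * (E * M))).
  by ring.
have c0M : c0 * M = c0 * (a + a' * t) + t ^+ 2 * (c0 * r) by rewrite /M /r1; ring.
have c1M : c1 * t * M = c1 * a * t + t ^+ 2 * (c1 * r1) by rewrite /M; ring.
by rewrite c0M c1M {1}Mq; ring.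
Qed.

(** Composing [t + al t^(i+1) + ...] with [t + be t^(j+1) + ...] adds the
    perturbations, and the first interaction is in degree [i + j + 1]; it is
    kept here up to one degree more, because the two coordinates of a diamond
    are adjacent coefficients. *)
Lemma comp_expand (R : comNzRingType) (i j : nat) (al al' be be' : R) (S T : {poly R}) : (0 < j)%N ->
  eqX (i + j + 3)
    (('X + 'X^(i.+1) * (al%:P + al'%:P * 'X + 'X^2 * S)) \Po
       ('X * (1 + 'X^j * (be%:P + be'%:P * 'X + 'X^2 * T))))
    (('X + 'X^(i.+1) * (al%:P + al'%:P * 'X + 'X^2 * S))
     + 'X^(j.+1) * (be%:P + be'%:P * 'X + 'X^2 * T)
     + 'X^(i + j + 1) * ((al * (be *+ i.+1))%:P
        + (al * (be' *+ i.+1 + (be ^+ 2 *+ 'C(i.+1, 2)) *+ (j == 1%N))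
           + al' * (be *+ i.+2))%:P * 'X)).
Proof.
move=> j0; set H := 'X * _.
have [E HE] := expand_exp 'X be%:P be'%:P T i.+1 j0.
have H0 : H`_0 = 0 by rewrite /H coefXM.
have HX : H = 'X + 'X^(j.+1) * (be%:P + be'%:P * 'X + 'X^2 * T).
  by rewrite /H !exprS; ring.
have [D SD] : eqX j.+1 (S \Po H) S.
  rewrite -[X in eqX _ _ X]comp_polyXr; apply: eqX_comp => //; first exact: eqX_refl.
  by exists (be%:P + be'%:P * 'X + 'X^2 * T); rewrite HX.
rewrite comp_polyD comp_polyX comp_polyM comp_Xn_poly.
rewrite !comp_polyD (comp_polyM al'%:P) (comp_polyM 'X^2) !comp_polyC.
rewrite comp_Xn_poly comp_polyX {}SD {}HE.
rewrite !polyCD !polyCM !polyCD !polyCMn polyCM.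
rewrite -[be%:P * be%:P]expr2 [be%:P + be%:P *+ _]addrC.
set c0 := be%:P *+ i.+1; set c1 := _ + _ *+ (j == 1%N).
move: (al%:P) (al'%:P) (be%:P) (be'%:P) c0 c1 HX => a a' b b' c0 c1 HX.
rewrite {}HX {H0 H}; case: j j0 => // j _.
have [Z /= HZ] := comp_expand_ring ('X ^+ i.+1) ('X ^+ j) 'X a a' b b' c0 c1 S T D E.
exists Z.
rewrite [(i + j.+1 + 1)%N](_ : _ = i.+1 + j.+1)%N; last by lia.
rewrite [(i + j.+1 + 3)%N](_ : _ = i.+1 + j.+1 + 2)%N; last by lia.
by rewrite !exprD ['X ^+ j.+2]exprS ['X ^+ j.+1]exprS.
Qed.
End Expansion.

(** * Coefficients of a product *)

Section Coefficients.
Local Open Scope ring_scope.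
Variable p : nat.
Implicit Types (f g h : nottingham p) (i j n M : nat).

Lemma trunc_depth f d M : (0 < d)%N -> nott_sub d f -> (d.+2 <= M)%N ->
  exists S, trunc M f =
    'X + 'X^(d.+1) * ((f d.+1)%:P + (f d.+2)%:P * 'X + 'X^2 * S).
Proof.
move=> d0 fd dM.
have [S HS] : eqX d.+3 (trunc M f)
    ('X + 'X^(d.+1) * ((f d.+1)%:P + (f d.+2)%:P * 'X)).
  apply: coef_eqX => i iM; rewrite coef_trunc; last by lia.
  rewrite coefD coefX coefXnM coefD coefC coefMX coefC.
  have [id|id] := ltnP i d.+1.
    by case: i id iM => [|[|i]] id _; rewrite ?addr0 ?ncoef0 ?ncoef1// fd//; lia.
  have -> : (i == 1%N) = false by lia.
  have [->|id2] := eqVneq i d.+1; first by rewrite subnn !addr0 add0r.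
  have -> : i = d.+2 by lia.
  by rewrite subSn// subnn /= !add0r.
exists S; rewrite HS -[d.+3](addn2 d.+1) exprD.
by move: ('X ^+ d.+1) => u; ring.
Qed.

Lemma mul_coef_trunc f h n M : (n <= M)%N ->
  (f * h)%g n = (trunc M f \Po trunc M h)`_n.
Proof.
move=> nM; rewrite nott_mulE /scomp; apply: (@eqX_coef _ n.+1) => //.
by apply: eqX_sym; apply: eqX_comp; rewrite ?coef_trunc ?ncoef0//; exact: eqX_trunc.
Qed.

(** All later computations in the group come from this formula: products are
    additive up to degree [i + j], and the two next degrees carry explicit
    bilinear corrections. *)
Lemma mul_depth_coef f h i j n : (0 < i)%N -> (0 < j)%N ->
  nott_sub i f -> nott_sub j h -> (1 < n <= i + j + 2)%N ->
  (f * h)%g n = f n + h n +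
    (if n == (i + j + 1)%N then f i.+1 * (h j.+1 *+ i.+1) else
     if n == (i + j + 2)%N then
       f i.+1 * (h j.+2 *+ i.+1 + h j.+1 ^+ 2 *+ 'C(i.+1, 2) *+ (j == 1%N))
         + f i.+2 * (h j.+1 *+ i.+2) else 0).
Proof.
move=> i0 j0 fi hj nij; pose M := (i + j + 2)%N.
rewrite (@mul_coef_trunc _ _ _ M); last by rewrite /M; lia.
have [|S FS] := @trunc_depth f i M i0 fi; first by rewrite /M; lia.
have [|T HT] := @trunc_depth h j M j0 hj; first by rewrite /M; lia.
have hE : 'X^(j.+1) * ((h j.+1)%:P + (h j.+2)%:P * 'X + 'X^2 * T) = trunc M h - 'X.
  by rewrite HT [RHS]addrAC subrr add0r.
have HT' : trunc M h = 'X * (1 + 'X^j * ((h j.+1)%:P + (h j.+2)%:P * 'X + 'X^2 * T)).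
  by rewrite HT exprS; ring.
rewrite HT' FS (eqX_coef (comp_expand i _ _ _ _ _ _ j0)); last by lia.
rewrite -FS hE !coefD coefN coefX !coef_trunc /M; try by lia.
have -> : (n == 1%N) = false by lia.
rewrite oppr0 addr0; congr (_ + _).
rewrite coefXnM coefD coefC coefMX coefC.
have [?|?] := ltnP n (i + j + 1); first by rewrite !ifF//; lia.
have [->|?] := eqVneq n (i + j + 1)%N; first by rewrite subnn addr0.
have -> : n = (i + j + 2)%N by lia.
have -> : (i + j + 2 - (i + j + 1) = 1)%N by lia.
by rewrite eqxx add0r.
Qed.

Lemma mul_low f h i j n : (0 < i)%N -> (0 < j)%N ->
  nott_sub i f -> nott_sub j h -> (1 < n <= i + j)%N -> (f * h)%g n = f n + h n.
Proof.
move=> i0 j0 fi hj nij; rewrite (mul_depth_coef i0 j0 fi hj); last by lia.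
by rewrite !ifF ?addr0//; lia.
Qed.

Lemma mul_mid f h i j : (0 < i)%N -> (0 < j)%N ->
  nott_sub i f -> nott_sub j h ->
  (f * h)%g (i + j + 1)%N =
    f (i + j + 1)%N + h (i + j + 1)%N + f i.+1 * (h j.+1 *+ i.+1).
Proof.
move=> i0 j0 fi hj; rewrite (mul_depth_coef i0 j0 fi hj); last by lia.
by rewrite eqxx.
Qed.

Lemma mul_high f h i j : (0 < i)%N -> (0 < j)%N ->
  nott_sub i f -> nott_sub j h ->
  (f * h)%g (i + j + 2)%N = f (i + j + 2)%N + h (i + j + 2)%N
    + (f i.+1 * (h j.+2 *+ i.+1 + h j.+1 ^+ 2 *+ 'C(i.+1, 2) *+ (j == 1%N))
         + f i.+2 * (h j.+1 *+ i.+2)).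
Proof.
move=> i0 j0 fi hj; rewrite (mul_depth_coef i0 j0 fi hj); last by lia.
by rewrite ifF ?eqxx//; lia.
Qed.

End Coefficients.

(** * Congruence modulo the depth filtration *)

Section Agreement.
Local Open Scope ring_scope.
Variable p : nat.
Implicit Types (f g h : nottingham p) (i j n : nat).

(** Congruence modulo N_n, see [agree_sub]. *)
Definition agree n f g := forall i, (i <= n)%N -> f i = g i.

Lemma agreeI n f g : (forall i, (1 < i <= n)%N -> f i = g i) -> agree n f g.
Proof. by move=> fg [|[|i]] im; rewrite ?ncoef0 ?ncoef1// fg. Qed.

Lemma agree_sym n f g : agree n f g -> agree n g f.
Proof. by move=> fg i im; rewrite fg. Qed.

Lemma agree_trans n f g h : agree n f g -> agree n g h -> agree n f h.
Proof. by move=> fg gh i im; rewrite fg ?gh. Qed.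

Lemma agree_le m n f g : (m <= n)%N -> agree n f g -> agree m f g.
Proof. by move=> mn fg i im; apply: fg; exact: leq_trans mn. Qed.

Lemma agreeM n f f' g g' : agree n f f' -> agree n g g' -> agree n (f * g)%g (f' * g')%g.
Proof.
move=> ff gg i im; rewrite !(@mul_coef_trunc _ _ _ i i)//.
by congr (_ \Po _)`_i; apply/polyP => j; rewrite !coef_poly; case: ifP => // ji;
  rewrite ?ff ?gg//; lia.
Qed.

Lemma agreeV n f g : agree n f g -> agree n f^-1%g g^-1%g.
Proof.
move=> fg; rewrite -[X in agree n X](mulgK g) -{2}[g^-1%g]mul1g -(mulVg f).
by apply: agreeM => //; apply: agreeM => //; exact: agree_sym.
Qed.

Lemma agreeX n k f g : agree n f g -> agree n (f ^+ k)%g (g ^+ k)%g.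
Proof. by move=> fg; elim: k => // k IH; rewrite !expgS; exact: agreeM. Qed.

Lemma agreeJ n f f' g g' : agree n f f' -> agree n g g' -> agree n (f ^ g)%g (f' ^ g')%g.
Proof.
by move=> ff gg; rewrite !conjgE; apply: agreeM; [exact: agreeV | exact: agreeM].
Qed.

Lemma ncoef_one i : (1%g : nottingham p) i = (i == 1%N)%:R.
Proof. by []. Qed.

Lemma sub_agree n f : nott_sub n f <-> agree n f 1%g.
Proof.
split=> [fn|f1 i im]; first by apply: agreeI => -[|[|i]]//= im; rewrite fn.
by rewrite f1; [case: i im => [|[|i]] | lia].
Qed.

Lemma agree_sub n f g : agree n f g <-> nott_sub n (f^-1 * g)%g.
Proof.
split=> [/nott_sub_div//|/sub_agree fg].
rewrite -[g](mulKVg f) -{1}[f]mulg1; apply: agreeM => //; exact: agree_sym.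
Qed.

Lemma sub_le m n f : (m <= n)%N -> nott_sub n f -> nott_sub m f.
Proof. by move=> mn fn i im; apply: fn; lia. Qed.

Lemma sub_all n f : (n <= 1)%N -> nott_sub n f.
Proof. by move=> n1 i im; lia. Qed.

Lemma sub_one n : nott_sub n (1%g : nottingham p).
Proof. exact/sub_agree. Qed.

Lemma sub_mul n f g : nott_sub n f -> nott_sub n g -> nott_sub n (f * g)%g.
Proof. by move=> /sub_agree f1 /sub_agree g1; apply/sub_agree; rewrite -[1%g]mulg1; exact: agreeM. Qed.

Lemma sub_inv n f : nott_sub n f -> nott_sub n f^-1%g.
Proof. by move=> /sub_agree f1; apply/sub_agree; rewrite -[1%g]invg1; exact: agreeV. Qed.

Lemma sub_exp n k f : nott_sub n f -> nott_sub n (f ^+ k)%g.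
Proof. by move=> /sub_agree f1; apply/sub_agree; rewrite -(expg1n _ k); exact: agreeX. Qed.

Lemma sub_conj n f g : nott_sub n f -> nott_sub n (f ^ g)%g.
Proof. by move=> /sub_agree f1; apply/sub_agree; rewrite -(conj1g g); exact: agreeJ. Qed.

Lemma agree_subW n f g : agree n f g -> nott_sub n f -> nott_sub n g.
Proof. by move=> fg /sub_agree f1; apply/sub_agree; apply: agree_trans f1; exact: agree_sym. Qed.

Lemma sub_next n f : nott_sub n f -> f n.+1 = 0 -> nott_sub n.+1 f.
Proof. by move=> fn f0 i im; have [->//|ne] := eqVneq i n.+1; apply: fn; lia. Qed.

(** This and the next lemma turn a difference of coefficients of two products
    into coefficients of their quotient, as needed for commutators. *)
Lemma agree_div_mid n f g : (0 < n)%N -> agree n f g ->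
  g n.+1 = f n.+1 + (f^-1 * g)%g n.+1.
Proof.
move=> n0 /agree_sub fg; rewrite -{1}[g](mulKVg f).
by rewrite (mul_low (ltn0Sn 0) n0 (@sub_all 1 f isT) fg)//; lia.
Qed.

Lemma agree_div_high n f g : (0 < n)%N -> agree n f g ->
  g n.+2 = f n.+2 + (f^-1 * g)%g n.+2 + f 2%N * ((f^-1 * g)%g n.+1 *+ 2).
Proof.
move=> n0 /agree_sub fg; rewrite -{1}[g](mulKVg f).
have := mul_mid (ltn0Sn 0) n0 (@sub_all 1 f isT) fg.
by rewrite [(1 + n + 1)%N](_ : _ = n.+2)//; lia.
Qed.

End Agreement.

(** * Commutators and depth *)

Section Commutators.
Local Open Scope ring_scope.
Variable p : nat.
Implicit Types (f g h : nottingham p) (i j n : nat).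

Lemma agree_commute f g i j : (0 < i)%N -> (0 < j)%N -> nott_sub i f -> nott_sub j g ->
  agree (i + j) (g * f)%g (f * g)%g.
Proof.
move=> i0 j0 fi gj; apply: agreeI => n nij.
by rewrite (mul_low i0 j0 fi gj)// (mul_low j0 i0 gj fi) 1?addrC// addnC.
Qed.

Lemma commgE f g : [~ f, g]%g = ((g * f)^-1 * (f * g))%g.
Proof. by rewrite commgEl conjgE invgM !mulgA. Qed.

Lemma comm_depth f g i j : (0 < i)%N -> (0 < j)%N -> nott_sub i f -> nott_sub j g ->
  nott_sub (i + j) [~ f, g]%g.
Proof. by move=> *; rewrite commgE; apply/agree_sub; exact: agree_commute. Qed.

(** The Lie bracket of [t^(i+1)] and [t^(j+1)] as vector fields, up to sign. *)
Lemma comm_lead f g i j : (0 < i)%N -> (0 < j)%N -> nott_sub i f -> nott_sub j g ->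
  [~ f, g]%g (i + j).+1 = (i%:R - j%:R) * (f i.+1 * g j.+1).
Proof.
move=> i0 j0 fi gj; rewrite commgE.
have ij0 : (0 < i + j)%N by lia.
have := agree_div_mid ij0 (agree_commute i0 j0 fi gj).
have -> : ((i + j).+1 = i + j + 1)%N by lia.
rewrite (mul_mid i0 j0 fi gj) [(i + j)%N]addnC (mul_mid j0 i0 gj fi).
set c := ncoef (_^-1 * _)%g _ => E.
have -> : c = f i.+1 * (g j.+1 *+ i.+1) - g j.+1 * (f i.+1 *+ j.+1).
  by apply: (addrI (g (j + i + 1)%N + f (j + i + 1)%N + g j.+1 * (f i.+1 *+ j.+1)));
     rewrite -E; ring.
by ring.
Qed.

End Commutators.

(** * Coordinates on a diamond *)

Section Coordinates.
Local Open Scope ring_scope.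
Variable p : nat.
Implicit Types (f g h : nottingham p) (i j n d : nat).

(** For [d > 0], [coord1 d] and [coord2 d] are the coordinates of an element of
    N_d in the elementary abelian group N_d/N_(d+2). For [d = 1] the
    coefficient of [t^3] is not additive, which the quadratic term repairs. *)
Definition coord1 d f := f d.+1.
Definition coord2 d f := f d.+2 - f 2%N ^+ 2 *+ (d == 1%N).

Lemma coord1_agree n d f g : (d < n)%N -> agree n f g -> coord1 d f = coord1 d g.
Proof. by move=> dn fg; apply: fg. Qed.

Lemma coord2_agree n d f g : (d.+1 < n)%N -> agree n f g -> coord2 d f = coord2 d g.
Proof. by move=> dn fg; rewrite /coord2 !fg//; lia. Qed.

Lemma coord1M d f g : (0 < d)%N -> nott_sub d f -> nott_sub d g ->
  coord1 d (f * g)%g = coord1 d f + coord1 d g.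
Proof. by move=> d0 fd gd; rewrite /coord1 (mul_low d0 d0)//; lia. Qed.

Lemma coord2M d f g : (0 < d)%N -> nott_sub d f -> nott_sub d g ->
  coord2 d (f * g)%g = coord2 d f + coord2 d g.
Proof.
case: d => [//|[|d]] _ fd gd; rewrite /coord2.
  have f1 := @sub_all _ 1 f isT; have g1 := @sub_all _ 1 g isT.
  have -> := mul_low (ltn0Sn 0) (ltn0Sn 0) f1 g1 (isT : 1 < 2 <= 2)%N.
  have -> : (f * g)%g 3%N = f 3%N + g 3%N + f 2%N * (g 2%N *+ 2).
    exact: mul_mid (ltn0Sn 0) (ltn0Sn 0) f1 g1.
  by rewrite eqxx !mulr1n; ring.
by rewrite (_ : (d.+2 == 1)%N = false)// !mulr0n !subr0 (mul_low _ _ fd gd)//; lia.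
Qed.

Lemma coord1_one d : (0 < d)%N -> coord1 d (1%g : nottingham p) = 0.
Proof. by case: d. Qed.

Lemma coord2_one d : coord2 d (1%g : nottingham p) = 0.
Proof. by rewrite /coord2 !ncoef_one /= expr2 mul0r mul0rn subr0. Qed.

Lemma coord1X d f n : (0 < d)%N -> nott_sub d f -> coord1 d (f ^+ n)%g = coord1 d f *+ n.
Proof.
move=> d0 fd; elim: n => [|n IH]; first by rewrite expg0 coord1_one.
by rewrite expgS coord1M// ?IH ?mulrS//; exact: sub_exp.
Qed.

Lemma coord2X d f n : (0 < d)%N -> nott_sub d f -> coord2 d (f ^+ n)%g = coord2 d f *+ n.
Proof.
move=> d0 fd; elim: n => [|n IH]; first by rewrite expg0 coord2_one.
by rewrite expgS coord2M// ?IH ?mulrS//; exact: sub_exp.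
Qed.

Lemma coord1V d f : (0 < d)%N -> nott_sub d f -> coord1 d f^-1%g = - coord1 d f.
Proof.
move=> d0 fd; apply: (addrI (coord1 d f)).
by rewrite -coord1M ?mulgV ?coord1_one ?subrr//; exact: sub_inv.
Qed.

Lemma coord2V d f : (0 < d)%N -> nott_sub d f -> coord2 d f^-1%g = - coord2 d f.
Proof.
move=> d0 fd; apply: (addrI (coord2 d f)).
by rewrite -coord2M ?mulgV ?coord2_one ?subrr//; exact: sub_inv.
Qed.

Lemma sub_co d f : (0 < d)%N -> nott_sub d f -> coord1 d f = 0 -> coord2 d f = 0 ->
  nott_sub d.+2 f.
Proof.
rewrite /coord1 /coord2 => d0 fd f1 f2; apply: sub_next; first exact: sub_next.
move: f2; have [E|_] := eqVneq d 1%N; last by rewrite mulr0n subr0.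
have -> : f 2%N = 0 by rewrite -f1 E.
by rewrite expr0n mul0rn subr0.
Qed.

Lemma agree_co d f g : (0 < d)%N -> nott_sub d f -> nott_sub d g ->
  coord1 d f = coord1 d g -> coord2 d f = coord2 d g -> agree d.+2 f g.
Proof.
move=> d0 fd gd e1 e2; apply/agree_sub/sub_co => //.
- by apply: sub_mul => //; exact: sub_inv.
- by rewrite coord1M ?coord1V ?e1 ?addNr//; exact: sub_inv.
- by rewrite coord2M ?coord2V ?e2 ?addNr//; exact: sub_inv.
Qed.

(** The commutators with elements of depth 1 shift the depth by 1 with
    coefficient [d - 1], which vanishes. *)
Lemma agree_conj d f g : (0 < d)%N -> d%:R = 1 :> 'F_p -> nott_sub d f ->
  agree d.+2 (f ^ g)%g f.
Proof.
move=> d0 d1 fd; suff fg : agree d.+2 (f * g)%g (g * f)%g.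
  by rewrite conjgE -{2}[f](mulKg g); exact: agreeM.
apply: agreeI => n nd; have g1 := @sub_all _ 1 g isT.
have [nd1|nd1] := leqP n (d + 1).
  rewrite (mul_low d0 _ fd g1)//; last by lia.
  by rewrite (mul_low _ d0 g1 fd)// 1?addrC//; lia.
have -> : n = (d + 1 + 1)%N by lia.
rewrite (mul_mid d0 (ltn0Sn 0) fd g1) [(d + 1 + 1)%N](_ : _ = 1 + d + 1)%N; last by lia.
rewrite (mul_mid (ltn0Sn 0) d0 g1 fd) -[g 2%N *+ _]mulr_natr -natr1 d1; ring.
Qed.

Lemma coord1J d f g : (0 < d)%N -> d%:R = 1 :> 'F_p -> nott_sub d f ->
  coord1 d (f ^ g)%g = coord1 d f.
Proof. by move=> d0 d1 fd; apply: (coord1_agree _ (agree_conj g d0 d1 fd)). Qed.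

Lemma coord2J d f g : (0 < d)%N -> d%:R = 1 :> 'F_p -> nott_sub d f ->
  coord2 d (f ^ g)%g = coord2 d f.
Proof. by move=> d0 d1 fd; apply: (coord2_agree _ (agree_conj g d0 d1 fd)). Qed.

End Coordinates.

(** * Finite differences of a substitution *)

Section Differences.
Local Open Scope ring_scope.
Variable R : comNzRingType.
Implicit Types G : {poly R}.

Fixpoint comp_iter G n : {poly R} := if n is m.+1 then comp_iter G m \Po G else 'X.

Fixpoint comp_diff G n : {poly R} :=
  if n is m.+1 then (comp_diff G m \Po G) - comp_diff G m else 'X.

(** Binomial formula for the powers of 1 + delta, where delta sends [P] to
    [P \Po G - P]. *)
Lemma comp_iter_diff G n :
  comp_iter G n = \sum_(i < n.+1) comp_diff G i *+ 'C(n, i).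
Proof.
elim: n => [|n IH]; first by rewrite big_ord_recl big_ord0 bin0 mulr1n addr0.
rewrite /= {}IH (raddf_sum (comp_poly G)) /=.
under eq_bigr => i _ do rewrite raddfMn /= -[_ \Po _](subrK (comp_diff G i)) mulrnDl.
rewrite big_split /= addrC [RHS]big_ord_recl bin0 /= big_ord_recl bin0 /=.
rewrite -addrA; congr (_ + _); under [RHS]eq_bigr => i _ do rewrite binS mulrnDr.
rewrite big_split /= addrC [RHS]addrC; congr (_ + _).
by rewrite [RHS]big_ord_recr /= bin_small// mulr0n addr0.
Qed.

Lemma comp_iter_pchar G p : p \in [pchar R] ->
  comp_iter G p = 'X + comp_diff G p.
Proof.
move=> pR; have p_pr := pcharf_prime pR; have p0 := prime_gt0 p_pr.
case: p p0 pR p_pr => // p _ pR p_pr.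
rewrite comp_iter_diff big_ord_recl big_ord_recr /= bin0 binn !mulr1n big1 ?add0r// => i _.
have : (p.+1 %| 'C(p.+1, bump 0 i))%N.
  by apply: prime_dvd_bin => //; rewrite /bump /=; have := ltn_ord i; lia.
case/dvdnP => q ->; rewrite mulnC mulrnA -[_ *+ p.+1]mulr_natr -polyC_natr.
by rewrite (pcharf0 pR) polyC0 mulr0 mul0rn.
Qed.

End Differences.

(** * Depth and slope of p-th powers *)

Section PowerFormula.
Local Open Scope ring_scope.
Variable p : nat.
Implicit Types (f g h : nottingham p) (i j n K : nat).

Lemma zdist0 : zdist p 0 = 2.
Proof. by rewrite /zdist big_geq. Qed.

Lemma zdistS m : (zdist p m.+1 - 1 = p * (zdist p m - 1) + 1)%N.
Proof.
rewrite /zdist big_ltn// expn1 big_add1 /=.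
under eq_bigr => i _ do rewrite expnS.
by rewrite -big_distrr /=; set s := bigop _ _ _; nia.
Qed.

Lemma zdist_gt0 m : (0 < zdist p m - 1)%N.
Proof. by rewrite /zdist; lia. Qed.

Hypothesis p_pr : prime p.

Let p_char : p \in [pchar 'F_p].
Proof. exact: pchar_Fp. Qed.

Lemma natFp_p : p%:R = 0 :> 'F_p.
Proof. exact: pcharf0. Qed.

Lemma natFp_eq0 n : (n%:R == 0 :> 'F_p) = (p %| n)%N.
Proof. by rewrite (dvdn_pcharf p_char). Qed.

Lemma natFp_neq0 n : (0 < n < p)%N -> n%:R != 0 :> 'F_p.
Proof. by move=> np; rewrite natFp_eq0 gtnNdvd//; lia. Qed.

Lemma natFp_surj (x : 'F_p) : exists n : nat, x = n%:R.
Proof. by exists (val x); rewrite natr_Zp. Qed.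

Lemma zdist_mod m : (zdist p m - 1)%:R = 1 :> 'F_p.
Proof.
case: m => [|m]; first by rewrite zdist0.
by rewrite zdistS natrD natrM natFp_p mul0r add0r.
Qed.

Lemma zdist_inj m n : zdist p m = zdist p n -> m = n.
Proof.
have p1 := prime_gt1 p_pr.
have lt i : (zdist p i < zdist p i.+1)%N.
  by have := zdistS i; have := zdist_gt0 i; nia.
have mono : {homo zdist p : i j / (i < j)%N} by apply: homo_ltn => //; exact: ltn_trans.
by move=> E; case: (ltngtP m n) => // /mono; rewrite E ltnn.
Qed.

Lemma expg_trunc g n M :
  eqX M.+1 (trunc M (g ^+ n)%g) (comp_iter (trunc M g) n).
Proof.
elim: n => [|n IH]; first by rewrite expg0 /=; exact: trunc_sid.
rewrite expgSr /=; apply: eqX_trans (trunc_scomp _ _ (ncoef0 g)) _.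
by apply: eqX_comp IH (eqX_refl _ _); rewrite coef_trunc ?ncoef0.
Qed.

(** The two lowest coefficients of the [n]-th difference of ['X] under a
    substitution [t + A t^(K+1) + B t^(K+2) + ...]. *)
Fixpoint diff_lead K (A B : 'F_p) n : 'F_p * 'F_p :=
  if n is m.+1 then
    let: (al, be) := diff_lead K A B m in
    (al * (A *+ (m * K).+1),
     al * (B *+ (m * K).+1 + A ^+ 2 *+ 'C((m * K).+1, 2) *+ (K == 1%N))
       + be * (A *+ (m * K).+2))
  else (1, 0).

Lemma comp_diff_lead g K M n : (0 < K)%N -> nott_sub K g -> (K.+2 <= M)%N ->
  let ab := diff_lead K (g K.+1) (g K.+2) n in
  exists E, comp_diff (trunc M g) n =
    'X^((n * K).+1) * (ab.1%:P + ab.2%:P * 'X + 'X^2 * E).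
Proof.
move=> K0 gK KM /=; have [S GS] := trunc_depth K0 gK KM.
have GS' : trunc M g = 'X * (1 + 'X^K * ((g K.+1)%:P + (g K.+2)%:P * 'X + 'X^2 * S)).
  by rewrite GS exprS; ring.
elim: n => [|n [E IH]] /=; first by exists 0; rewrite mul0n polyC0; ring.
case: (diff_lead _ _ _ n) IH => al be /= IH.
set D := comp_diff _ _ in IH *.
have := comp_expand (n * K) al be (g K.+1) (g K.+2) E S K0.
rewrite -{}GS' -{}IH => -[Z].
rewrite comp_polyD comp_polyX => HZ.
have -> : D \Po trunc M g - D = ('X + D - D + 'X^(K.+1) *
  ((g K.+1)%:P + (g K.+2)%:P * 'X + 'X^2 * S) - trunc M g) +
  (trunc M g + (D \Po trunc M g) - 'X - D - 'X^(K.+1) *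
  ((g K.+1)%:P + (g K.+2)%:P * 'X + 'X^2 * S)) by ring.
rewrite {}HZ GS; exists Z.
rewrite mulSn [(n * K + K + 3)%N](_ : _ = (K + n * K).+1 + 2)%N; last by lia.
rewrite [(n * K + K + 1)%N](_ : _ = (K + n * K).+1)%N; last by lia.
rewrite exprD; move: ('X^((K + n * K).+1)) ('X^(K.+1) * _) => u v.
by ring.
Qed.

Hypothesis p_odd : odd p.

(** By [comp_iter_pchar] the series of [g ^+ p] is [t] plus the [p]-th
    difference. Its lowest coefficient is [p! A^p = 0]. In the recursion for
    the second one, the factors divisible by [p] kill all terms but one, in
    which [(p - 2)! = 1] remains by Wilson's theorem. *)
Lemma exp_p_depth g K : (0 < K)%N -> K%:R = 1 :> 'F_p -> nott_sub K g ->
  nott_sub (p * K + 1) (g ^+ p)%g /\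
  coord1 (p * K + 1) (g ^+ p)%g = - coord1 K g ^+ p.-1 * coord2 K g.
Proof.
move=> K0 K1 gK; set A := g K.+1; set B := g K.+2.
have p2 : (2 < p)%N := odd_prime_gt2 p_odd p_pr.
pose a n := (diff_lead K A B n).1; pose b n := (diff_lead K A B n).2.
have aS n : a n.+1 = a n * (A *+ n.+1).
  rewrite /a /=; case: (diff_lead K A B n) => al be /=.
  by rewrite -mulr_natr -natr1 natrM K1 mulr1 natr1 mulr_natr.
have bS n : b n.+1 = a n * (B *+ n.+1 + A ^+ 2 *+ 'C(n.+1, 2) *+ (K == 1%N))
    + b n * (A *+ n.+2).
  rewrite /a /b /=; case: (diff_lead K A B n) => al be /=.
  congr (_ * (_ + _) + _ * _).
  - by rewrite -mulr_natr -natr1 natrM K1 mulr1 natr1 mulr_natr.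
  - by case: (eqVneq K 1%N) => [->|]; rewrite ?mulr0n// muln1.
  - by rewrite -mulr_natr -2!natr1 natrM K1 mulr1 !natr1 mulr_natr.
have aE n : a n = n`!%:R * A ^+ n.
  elim: n => [|n IH]; first by rewrite /a /= fact0 expr0 mulr1.
  by rewrite aS IH factS natrM exprS -mulr_natr; ring.
have ap : a p = 0.
  rewrite aE; have /eqP -> : p`!%:R == 0 :> 'F_p by rewrite natFp_eq0 dvdn_fact ?leqnn ?prime_gt0.
  by rewrite mul0r.
have bp : b p = - A ^+ p.-1 * coord2 K g.
  have [q pq] : exists q, p = q.+3 by exists (p - 3)%N; lia.
  have pm1 : p.-1 = q.+2 by rewrite pq.
  have np n : (p %| n)%N -> n%:R = 0 :> 'F_p by rewrite -natFp_eq0 => /eqP.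
  have p0 : q.+3%:R = 0 :> 'F_p by rewrite np// pq.
  have q2 : q.+2%:R = -1 :> 'F_p by apply: (addIr 1); rewrite natr1 p0 addNr.
  have fq : q.+1`!%:R = 1 :> 'F_p.
    have := Wilson (prime_gt1 p_pr); rewrite p_pr => /esym /np.
    rewrite pm1 -natr1 factS natrM q2 => E.
    by apply/oppr_inj/(addIr 1); rewrite addNr -E; ring.
  have Cp : 'C(q.+3, 2)%:R = 0 :> 'F_p by apply: np; rewrite -pq; apply: prime_dvd_bin; lia.
  have Cp1 : 'C(q.+2, 2)%:R = 1 :> 'F_p.
    by move: Cp; rewrite binS bin1 natrD q2 => /eqP; rewrite subr_eq0 => /eqP.
  have -> : b p = b q.+3 by congr (b _).
  rewrite pm1 bS bS (aE q.+1) fq mul1r -![B *+ _]mulr_natr -![A *+ _]mulr_natr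
    -![A ^+ 2 *+ _]mulr_natr q2 p0 Cp Cp1 -natr1 p0 /coord2 -/B /=.
  have [K2|_] := eqVneq K 1%N; last by rewrite !mulr0n !exprS; ring.
  have -> : g 2%N = A by rewrite /A K2.
  by rewrite !mulr1n !exprS; ring.
have coefE n : (1 < n < p * K + 3)%N ->
    (g ^+ p)%g n = if n == (p * K + 2)%N then b p else 0.
  move=> nK; have KM : (K.+2 <= p * K + 3)%N by have := prime_gt0 p_pr; nia.
  have [E HE] := comp_diff_lead p K0 gK KM.
  rewrite -(@coef_trunc _ (p * K + 3) _ n); last by lia.
  rewrite (eqX_coef (expg_trunc g p _)); last by lia.
  rewrite comp_iter_pchar// HE coefD coefX coefXnM -/A -/B -/(a p) -/(b p) ap.
  have -> : (n == 1%N) = false by lia.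
  rewrite add0r polyC0 add0r; have [nK1|nK1] := ltnP n (p * K).+1; first by rewrite ifF//; lia.
  rewrite coefD coefMX coefC coefXnM; have [->|nK2] := eqVneq n (p * K + 2)%N.
    have -> : (p * K + 2 - (p * K).+1 = 1)%N by lia.
    by rewrite /= addr0.
  have -> : (n - (p * K).+1 = 0)%N by lia.
  by rewrite /= addr0.
split=> [i iK|]; first by rewrite coefE ?ifF//; lia.
by rewrite /coord1 coefE -?bp ?ifT//; lia.
Qed.

(** Compare the coefficients of [t^(K+3)] in [f * g] and [g * f]: the terms of
    lower degree agree for every [g] in the diamond. *)
Lemma centralizer_slope f g K : (1 < K)%N -> K%:R = 1 :> 'F_p -> nott_sub K g ->
  commute f g -> coord1 1 f * coord2 K g = coord1 K g * coord2 1 f.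
Proof.
move=> K2 K1 gK fg; have K0 : (0 < K)%N by lia.
have f1 := @sub_all _ 1 f isT.
have E : (f * g)%g (1 + K + 2)%N = (g * f)%g (K + 1 + 2)%N.
  by rewrite fg [(1 + K)%N]addnC.
move: E; rewrite (mul_high (ltn0Sn 0) K0 f1 gK) (mul_high K0 (ltn0Sn 0) gK f1).
rewrite [(1 + K)%N]addnC; move: (f (K + 1 + 2)%N) (g (K + 1 + 2)%N) => u v.
have C1 : 'C(K.+1, 2)%:R = 1 :> 'F_p.
  have : 2%:R * 'C(K.+1, 2)%:R = 2%:R :> 'F_p.
    by rewrite -natrM -mul_bin_diag bin1 natrM -natr1 K1 mulr1.
  have n2 : 2%:R != 0 :> 'F_p by apply: natFp_neq0; exact: odd_prime_gt2.
  by move=> C2; apply: (mulfI n2); rewrite C2 mulr1.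
rewrite -[_ *+ 'C(K.+1, 2)]mulr_natr C1 -[_ *+ K.+1]mulr_natr -[_ *+ K.+2]mulr_natr.
have -> : (K == 1%N) = false by lia.
rewrite -[K.+2%:R]natr1 -[K.+1%:R]natr1 K1.
rewrite /coord1 /coord2 (_ : (K == 1%N) = false); last by lia.
rewrite binn !eqxx !mulr0n !mulr1n => /eqP; rewrite -subr_eq0 => /eqP E.
by apply/eqP; rewrite -subr_eq0 -oppr_eq0; apply/eqP; rewrite -[RHS]E; ring.
Qed.

(** [g] has depth exactly [d], and in the plane of depth [d] the same slope as
    [f] has in depth 1. *)
Definition slope_at f d g :=
  [/\ nott_sub d g, coord1 d g != 0 & coord1 1 f * coord2 d g = coord1 d g * coord2 1 f].

(** Each p-th power has the right depth by [exp_p_depth], since the slope is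
    not 0; it commutes with [f], and so has the slope of [f] by
    [centralizer_slope], which is again not 0. *)
Lemma slope_exp_p f l : coord1 1 f != 0 -> coord2 1 f != 0 ->
  slope_at f (zdist p l - 1) (f ^+ (p ^ l))%g.
Proof.
move=> a0 b0; elim: l => [|l [sub l0 sl]].
  by rewrite expn0 expg1 zdist0; split=> //; rewrite ?mulrC//; exact: sub_all.
have [] := exp_p_depth (zdist_gt0 l) (zdist_mod l) sub.
rewrite expnSr expgnA zdistS => sub' lead; split=> //.
  rewrite lead mulf_neq0 ?oppr_eq0 ?expf_neq0//.
  by apply: contraNneq (mulf_neq0 l0 b0) => E; rewrite -sl E mulr0.
apply: centralizer_slope => //.
- by have := zdist_gt0 l; have := prime_gt0 p_pr; nia.
- by rewrite -zdistS zdist_mod.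
- exact/commuteX/commuteX.
Qed.

Lemma slope_exp f n : coord1 1 f != 0 -> coord2 1 f != 0 -> (0 < n)%N ->
  exists l, slope_at f (zdist p l - 1) (f ^+ n)%g.
Proof.
move=> a0 b0 n0; have [m pm ->] := pfactor_coprime p_pr n0.
exists (logn p n); have [sub l0 sl] := slope_exp_p (logn p n) a0 b0.
rewrite mulnC expgnA; have m0 : m%:R != 0 :> 'F_p by rewrite natFp_eq0 -prime_coprime.
have z0 := zdist_gt0 (logn p n); split.
- exact: sub_exp.
- by rewrite coord1X// -mulr_natr mulf_neq0.
- by rewrite coord1X// coord2X// mulrnAr mulrnAl sl.
Qed.

End PowerFormula.

(** * Elements of order p *)

Section OrderP.
Local Open Scope ring_scope.
Variable p : nat.
Hypotheses (p_pr : prime p).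
Implicit Types (f g h : nottingham p) (i j n d : nat).

Lemma eqX_exp (R : comNzRingType) m k (P Q : {poly R}) :
  eqX m P Q -> eqX m (P ^+ k) (Q ^+ k).
Proof.
move=> PQ; elim: k => [|k IH]; first exact: eqX_refl.
by rewrite !exprS; exact: eqX_mul.
Qed.

(** A series [P] with [P^d (1 - c t^d) = t^d] is translation by [- c] in the
    coordinate [t^(-d)], so that its iterates are known. *)
Lemma comp_iter_root (R : comNzRingType) (P : {poly R}) (c : R) d m n : P`_0 = 0 ->
  eqX m (P ^+ d * (1 - c *: 'X^d)) 'X^d ->
  eqX m (comp_iter P n ^+ d * (1 - (c *+ n) *: 'X^d)) 'X^d.
Proof.
move=> P0 Pd; elim: n => [|n IH] /=.
  by rewrite mulr0n scale0r subr0 mulr1; exact: eqX_refl.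
set F := comp_iter P n in IH *.
have E1 : eqX m ((F \Po P) ^+ d * (1 - (c *+ n) *: P ^+ d)) (P ^+ d).
  have := eqX_comp P0 IH (eqX_refl m P).
  by rewrite comp_polyM rmorphXn /= comp_polyB comp_polyC comp_polyZ !comp_Xn_poly.
have E2 := eqX_mul E1 (eqX_refl m (1 - c *: 'X^d)).
apply: eqX_trans (eqX_trans E2 Pd).
have -> : (F \Po P) ^+ d * (1 - (c *+ n) *: P ^+ d) * (1 - c *: 'X^d)
   = (F \Po P) ^+ d * ((1 - c *: 'X^d) - (c *+ n) *: (P ^+ d * (1 - c *: 'X^d))).
  by rewrite -!mul_polyC; ring.
apply: eqX_mul; first exact: eqX_refl.
case: Pd => Z ->; exists ((c *+ n) *: Z).
by rewrite mulrSr -!mul_polyC polyCD; ring.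
Qed.

(** The series is t (1 - d t^d)^(-1/d). Modulo a high power of [t] the exponent
    [-1/d] may be replaced by the integer [(p^r - 1)/d], to which it is
    congruent modulo [p^r]; this yields a polynomial. By [comp_iter_root] its
    [p]-th iterate has the same [d]-th power as ['X]. Order [p] modulo N_n, for
    [n] as large as desired, is all that matters in a quotient. *)
Lemma exists_order_p d n : (0 < d < p)%N -> (d %| p.-1)%N ->
  exists f : nottingham p, [/\ nott_sub d f, f d.+1 = 1 & nott_sub n (f ^+ p)%g].
Proof.
move=> /andP[d0 dp] dp1; pose r := (n + d).+1; have p1 := prime_gt1 p_pr.
have rp : (n + d < p ^ r)%N by apply: ltn_trans (ltn_expl _ p1).
have /dvdnP[M MM] : (d %| (p ^ r).-1)%N.
  by apply: dvdn_trans dp1 _; rewrite predn_exp dvdn_mulr.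
pose x : {poly 'F_p} := - (d%:R *: 'X^d).
have pX : p \in [pchar {poly 'F_p}] by rewrite pchar_poly pchar_Fp.
have bin_exp k : exists E, (1 + x) ^+ k = 1 + x *+ k + x ^+ 2 * E.
  elim: k => [|k [E IH]]; first by exists 0; rewrite expr0 mulr0n; ring.
  exists (k%:R + E * (1 + x)); rewrite exprSr IH mulrSr -[x *+ k]mulr_natr; ring.
have [E HE] := bin_exp M.
pose P := 'X * (1 + x) ^+ M.
have PE : P = 'X + 'X^(d.+1) * (1 + 'X^d * ((d ^ 2)%:R *: E)).
  rewrite /P HE.
  have -> : x *+ M = 'X^d.
    rewrite /x mulNrn scalerMnl -mulr_natr -natrM mulnC -MM.
    have : ((p ^ r).-1.+1)%:R = 0 :> 'F_p.
      by rewrite prednK ?expn_gt0 ?prime_gt0// natrX natFp_p// expr0n.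
    by rewrite -natr1 => /eqP; rewrite addr_eq0 => /eqP ->; rewrite scaleNr opprK scale1r.
  by rewrite /x natrX -!mul_polyC polyC_exp ['X^(d.+1)]exprS; move: ('X^d) => u; ring.
have P0 : P`_0 = 0 by rewrite /P coefXM.
have P1 : P`_1 = 1.
  by rewrite PE coefD coefX coefXnM; case: (d) d0 => // e _; rewrite addr0.
have fP : (P`_0 == 0) && (P`_1 == 1) by rewrite P0 P1 !eqxx.
pose f : nottingham p := Nottingham (fP : ((fun i => P`_i) 0%N == 0) && ((fun i => P`_i) 1%N == 1)).
exists f; split.
- move=> i /andP[i1 id]; rewrite /= PE coefD coefX coefXnM ltnS id addr0.
  by case: i i1 {id} => [|[|i]].
- rewrite /= PE coefD coefX coefXnM ltnn subnn coefD coef1 coefXnM d0 addr0.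
  by case: (d) d0 => // e _; rewrite add0r.
have root : eqX (p ^ r) (P ^+ d * (1 - d%:R *: 'X^d)) 'X^d.
  rewrite /P exprMn -exprM -MM -/x -mulrA -exprSr prednK ?expn_gt0 ?prime_gt0//.
  have -> : (1 + x) ^+ (p ^ r) = 1 + x ^+ (p ^ r).
    by rewrite exprDn_pchar ?expr1n// pnatX pnatE// pX.
  exists ('X^d * (- d%:R *: 'X^(d.-1)) ^+ (p ^ r)).
  rewrite mulrDr mulr1; congr (_ + _); rewrite mulrCA; congr (_ * _).
  by rewrite -exprMn -scalerAr -exprS prednK// scaleNr.
pose Mx := (n + d + p ^ r)%N.
have fpE : eqX (p ^ r) (trunc Mx (f ^+ p)%g) (comp_iter P p).
  apply: (@eqX_trans _ _ (comp_iter (trunc Mx f) p)).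
    by apply: eqX_le (expg_trunc f p Mx); rewrite /Mx; lia.
  suff : forall q, eqX (p ^ r) (comp_iter (trunc Mx f) q) (comp_iter P q) by apply.
  elim=> [|q IH] /=; first exact: eqX_refl.
  apply: eqX_comp IH _; first by rewrite coef_trunc.
  by apply: coef_eqX => i ip; rewrite coef_trunc// /Mx; lia.
have fpd : eqX (p ^ r) (trunc Mx (f ^+ p)%g ^+ d) 'X^d.
  apply: eqX_trans (eqX_exp d fpE) _.
  have := comp_iter_root p P0 root.
  by rewrite -[d%:R *+ p]mulr_natr natFp_p// mulr0 scale0r subr0 mulr1.
suff : forall j, (j <= n)%N -> nott_sub j (f ^+ p)%g by apply.
elim=> [|[|j] IH] jn; [exact: sub_all|exact: sub_all|].
have gj := IH (ltnW jn).
apply: sub_next => //; set g := (f ^+ p)%g in gj fpd *.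
have [|S GS] := @trunc_depth _ g j.+1 Mx (ltn0Sn j) gj; first by rewrite /Mx; lia.
have GS' : trunc Mx g = 'X * (1 + 'X^(j.+1) * ((g j.+2)%:P + (g j.+3)%:P * 'X + 'X^2 * S)).
  by rewrite GS exprS; ring.
have [Z HZ] := expand_exp 'X (g j.+2)%:P (g j.+3)%:P S d (ltn0Sn j).
have := eqX_coef fpd (i := (d + j.+1)%N); rewrite GS' HZ mulrDr mulr1 mulrA -exprD.
rewrite coefD !coefXn coefXnM ltnn subnn.
have dr : (d + j.+1 < p ^ r)%N by apply: leq_ltn_trans rp; lia.
rewrite !coefD coefMX coefXnM coefMn coefC /= !addr0 -mulr_natr.
move=> /(_ dr)/(canRL (addKr _)); rewrite addNr => E0.
have d_neq0 : d%:R != 0 :> 'F_p by apply: natFp_neq0; rewrite ?d0.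
by apply: (mulIf d_neq0); rewrite mul0r mulr_natr.
Qed.
End OrderP.

(** * Generation, and cyclic subgroups that meet trivially *)

Section Separation.
Local Open Scope ring_scope.
Variable p : nat.
Implicit Types (f g h x y u : nottingham p) (i j n d : nat).

(** The images in the plane N/N_3 are linearly independent. *)
Definition frattini_indep x y := coord1 1 x * coord2 1 y != coord2 1 x * coord1 1 y.

Definition separated n x y := forall i j g,
  agree n (x ^+ i)%g ((y ^+ j) ^ g)%g -> nott_sub n (x ^+ i)%g.

Lemma frattini_agree n x y i j g : (2 < n)%N -> agree n (x ^+ i)%g ((y ^+ j) ^ g)%g ->
  coord1 1 x * i%:R = coord1 1 y * j%:R /\ coord2 1 x * i%:R = coord2 1 y * j%:R.
Proof.
move=> n3 xy; have s1 (z : nottingham p) := @sub_all _ 1 z isT.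
by split; rewrite !mulr_natr; [rewrite -!coord1X// -(coord1J g _ _ (s1 (y ^+ j)%g))//; apply: coord1_agree xy; lia
          |rewrite -!coord2X// -(coord2J g _ _ (s1 (y ^+ j)%g))//; apply: coord2_agree xy; lia].
Qed.

Hypotheses (p_pr : prime p) (p_odd : odd p).

Let p_gt2 : (2 < p)%N := odd_prime_gt2 p_odd p_pr.

(** Commuting with an element of depth 1 raises the depth by 1 with a nonzero
    leading coefficient, except when the depth reached is 2 modulo [p]; there
    an element of depth 2 does it. So [H] has elements of every depth, and
    contains N up to N_n by successive approximation. *)
Lemma generation (H : set (nottingham p)) f h n : is_subgroup H ->
  H f -> f 2%N != 0 -> H h -> nott_sub 2 h -> h 3%N != 0 ->
  (forall x, nott_sub n x -> H x) -> forall g, H g.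
Proof.
move=> [H1 HM HV] Hf f2 Hh h2 h3 Hn.
have HX x k : H x -> H (x ^+ k)%g.
  by move=> Hx; elim: k => // k IH; rewrite expgS; exact: HM.
have HR x y : H x -> H y -> H [~ x, y]%g.
  by move=> Hx Hy; rewrite commgE; apply: (HM); [apply/HV/HM | exact: HM].
have f1 := @sub_all _ 1 f isT.
have depth j : (0 < j)%N -> exists x, [/\ H x, nott_sub j x & x j.+1 != 0].
  elim/ltn_ind: j => -[|[|[|j]]]// IH _; [by exists f | by exists h |].
  have [x [Hx xj xj1]] := IH j.+2 (ltnSn _) isT.
  have [y [Hy yj yj1]] := IH j.+1 (leqnSn _) isT.
  have [E|ne] := eqVneq (1%:R - j.+2%:R : 'F_p) 0.
    exists [~ h, y]%g; split; [exact: HR | exact: (comm_depth _ _ h2 yj) |].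
    rewrite (comm_lead (i := 2) _ _ h2 yj)// !mulf_neq0//.
    have -> : 2%:R - j.+1%:R = 2%:R :> 'F_p.
      have /eqP := E; rewrite -[j.+2%:R]natr1 opprD addrCA subrr addr0 oppr_eq0.
      by move=> /eqP ->; rewrite subr0.
    exact: natFp_neq0.
  exists [~ f, x]%g; split; [exact: HR | exact: (comm_depth _ _ f1 xj) |].
  by rewrite (comm_lead (i := 1) _ _ f1 xj)// !mulf_neq0.
move=> g; have approx j : exists2 x, H x & agree j.+1 x g.
  elim: j => [|j [x Hx xg]]; first by exists 1%g => //; apply: agreeI => i; lia.
  have [//|y [Hy yj yj1]] := depth j.+1.
  have [k kE] := natFp_surj ((x^-1 * g)%g j.+2 / y j.+2).
  have rj := (agree_sub _ _ _).1 xg.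
  exists (x * y ^+ k)%g; first exact/HM/HX.
  have yk := sub_exp k yj.
  apply/agree_sub; rewrite invgM -mulgA; apply: sub_next.
    by apply: sub_mul => //; exact: sub_inv.
  rewrite -[LHS]/(coord1 j.+1 _) coord1M//; last exact: sub_inv.
  by rewrite coord1V// coord1X// -mulr_natr -kE /coord1 mulrCA divff// mulr1 addNr.
have [x Hx xg] := approx n; rewrite -[g](mulKVg x); apply: (HM) => //.
by apply/Hn/(sub_le _ ((agree_sub _ _ _).1 xg)).
Qed.

Lemma natFp_eq1 n : n%:R = 1 :> 'F_p -> exists q, n = (q * p + 1)%N.
Proof.
case: n => [/esym/eqP|n]; first by rewrite oner_eq0.
rewrite -natr1 => /eqP; rewrite -subr_eq0 addrK natFp_eq0// => /dvdnP[q ->].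
by exists q; rewrite addn1.
Qed.

Lemma expg_mod x n m : nott_sub m (x ^+ p)%g -> n%:R = 1 :> 'F_p ->
  agree m (x ^+ n)%g x.
Proof.
move=> /sub_agree xp /natFp_eq1[q ->]; rewrite expgnDr expg1 mulnC expgnA.
rewrite -[X in agree _ _ X]mul1g; apply: agreeM => //.
by rewrite -(expg1n _ q); exact: agreeX.
Qed.

Lemma expg_dvd x n m : nott_sub m (x ^+ p)%g -> n%:R = 0 :> 'F_p ->
  nott_sub m (x ^+ n)%g.
Proof.
move=> xp /eqP; rewrite natFp_eq0// => /dvdnP[q ->].
by rewrite mulnC expgnA; exact: sub_exp.
Qed.

Lemma separated_order_p n x y : (2 < n)%N -> frattini_indep x y ->
  nott_sub n (x ^+ p)%g \/ nott_sub n (y ^+ p)%g -> separated n x y.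
Proof.
move=> n3 indep xyp i j g xy; have [e1 e2] := frattini_agree n3 xy.
have det_neq0 : coord1 1 x * coord2 1 y - coord2 1 x * coord1 1 y != 0 by rewrite subr_eq0.
case: xyp => [xp|yp].
  apply: expg_dvd => //; apply: (mulIf det_neq0); rewrite mul0r.
  transitivity ((coord1 1 x * i%:R) * coord2 1 y - (coord2 1 x * i%:R) * coord1 1 y); first by ring.
  by rewrite e1 e2; ring.
apply: agree_subW (agree_sym xy) _; apply/sub_conj/expg_dvd => //.
apply: (mulIf det_neq0); rewrite mul0r.
transitivity (coord1 1 x * (coord2 1 y * j%:R) - coord2 1 x * (coord1 1 y * j%:R)); first by ring.
by rewrite -e1 -e2; ring.
Qed.

(** A common power would have the depth of a distinguished diamond, below [n],
    and in that diamond the slopes of both [x] and [y]. *)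
Lemma separated_slope n x y : n%:R = 1 :> 'F_p -> frattini_indep x y ->
  coord1 1 x != 0 -> coord2 1 x != 0 -> coord1 1 y != 0 -> coord2 1 y != 0 -> separated n x y.
Proof.
move=> n1 indep ax bx ay by_ i j g xy; apply: contrapT => xn.
have yn : ~ nott_sub n ((y ^+ j) ^ g)%g.
  by move=> yn; apply: xn; apply: agree_subW yn; exact: agree_sym.
have i0 : (0 < i)%N by case: (i) xn => // -[]; exact: sub_one.
have j0 : (0 < j)%N by case: (j) yn => // -[]; rewrite expg0 conj1g; exact: sub_one.
have [l [xd x0 xs]] := slope_exp p_pr p_odd ax bx i0.
have [m [yd y0 ys]] := slope_exp p_pr p_odd ay by_ j0.
move: (zdist p l - 1)%N (zdist_gt0 p l) (zdist_mod p_pr l) xd x0 xs => d d0 d1 xd x0 xs.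
move: (zdist p m - 1)%N (zdist_gt0 p m) (zdist_mod p_pr m) yd y0 ys => e e0 e1 yd y0 ys.
have dn : (d < n)%N by rewrite ltnNge; apply/negP => nd; apply/xn/(sub_le nd).
have en : (e < n)%N by rewrite ltnNge; apply/negP => ne; apply/yn/(sub_le ne)/sub_conj.
have ygd := sub_conj g yd.
have yg0 : coord1 e ((y ^+ j) ^ g)%g != 0 by rewrite coord1J.
have de : d = e.
  case: (ltngtP d e) => // [de|ed].
    by move: x0; rewrite (coord1_agree dn xy) /coord1 ygd ?eqxx//; lia.
  by move: yg0; rewrite -(coord1_agree en xy) /coord1 xd ?eqxx//; lia.
subst e.
have dn2 : (d.+1 < n)%N.
  suff : (p %| n - d)%N by move=> /dvdn_leq; lia.
  by rewrite -natFp_eq0// natrB ?n1 ?d1 ?subrr// ltnW.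
have c1 := coord1_agree dn xy; have c2 := coord2_agree dn2 xy.
rewrite coord1J// in c1; rewrite coord2J// in c2.
have E : coord1 d (y ^+ j)%g * (coord1 1 x * coord2 1 y) = coord1 d (y ^+ j)%g * (coord2 1 x * coord1 1 y).
  transitivity (coord1 1 x * (coord1 d (y ^+ j)%g * coord2 1 y)); first by ring.
  rewrite -ys -c2; transitivity (coord1 1 y * (coord1 1 x * coord2 d (x ^+ i)%g)); first by ring.
  by rewrite xs c1; ring.
by move: indep; rewrite /frattini_indep (mulfI y0 E) eqxx.
Qed.

End Separation.

(** * Cubes in characteristic 3 *)

Section Cube.
Local Open Scope ring_scope.
Variable p : nat.
Implicit Types (f g h x y u : nottingham p) (i j n d : nat).

(** One degree more than [mul_low] gives: in that degree the corrections of the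
    two products add up to a multiple of 3, as the leading coefficients are
    the same. *)
Lemma mul3_coef f1 f2 f3 j n : 3%:R = 0 :> 'F_p -> (0 < j)%N ->
  nott_sub j f1 -> nott_sub j f2 -> nott_sub j f3 ->
  f1 j.+1 = f3 j.+1 -> f2 j.+1 = f3 j.+1 -> (1 < n <= j + j + 1)%N ->
  (f1 * f2 * f3)%g n = f1 n + f2 n + f3 n.
Proof.
move=> p3 j0 f1j f2j f3j e1 e2 nj; have f12 := sub_mul f1j f2j.
have [nj'|nj'] := leqP n (j + j).
  by rewrite (mul_low j0 j0 f12 f3j) ?(mul_low j0 j0 f1j f2j)//; lia.
have -> : n = (j + j + 1)%N by lia.
rewrite (mul_mid j0 j0 f12 f3j) (mul_mid j0 j0 f1j f2j) (mul_low j0 j0 f1j f2j); last by lia.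
rewrite e1 e2 -[X in _ = X]addr0 -[X in _ = _ + X](mulr0 (f3 j.+1 ^+ 2 *+ j.+1)) -p3.
by rewrite -[f3 j.+1 *+ _]mulr_natr -[_ ^+ 2 *+ _]mulr_natr; ring.
Qed.

Lemma conj_comm_coef x h i j n : (0 < i)%N -> (0 < j)%N -> nott_sub i x -> nott_sub j h ->
  (1 < n <= j + (j + i))%N -> (h ^ x)%g n = h n + [~ h, x]%g n.
Proof.
move=> i0 j0 xi hj nj.
have -> : (h ^ x = h * [~ h, x])%g by rewrite commgEl mulKVg.
by rewrite (mul_low j0 _ hj (comm_depth j0 i0 hj xi))//; lia.
Qed.

(** One has [(x h)^3 = x^3 h^(x^2) h^x h]. With [k = [~ h, x]] and
    [l = [~ k, x]], the product of conjugates is, to the order considered,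
    [h^3 k^3 l], whose leading term in characteristic 3 is that of [l]. *)
Lemma cube_perturb x h d j : 3%:R = 0 :> 'F_p -> (0 < d)%N -> (d.*2 <= j)%N ->
  nott_sub d x -> nott_sub j h ->
  nott_sub (j + d.*2) ((x ^+ 3)^-1 * (x * h) ^+ 3)%g /\
  ((x ^+ 3)^-1 * (x * h) ^+ 3)%g (j + d.*2).+1 =
    j%:R * (j%:R - d%:R) * (h j.+1 * x d.+1 ^+ 2).
Proof.
move=> p3 d0 dj xd hj; have j0 : (0 < j)%N by lia.
have -> : ((x ^+ 3)^-1 * (x * h) ^+ 3 = (h ^ x) ^ x * h ^ x * h)%g.
  by apply: (mulgI (x ^+ 3)%g); rewrite mulKVg !conjgE !expgSr expg0 !mul1g !mulgA !mulgK.
set k := [~ h, x]%g; have kj : nott_sub (j + d) k := comm_depth j0 d0 hj xd.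
have jd0 : (0 < j + d)%N by lia.
set l := [~ k, x]%g; have lj : nott_sub (j + d.*2) l.
  by have := comm_depth jd0 d0 kj xd; rewrite -addnn addnA.
have hx n : (1 < n <= j + j + 1)%N -> (h ^ x)%g n = h n + k n.
  by move=> nj; apply: (conj_comm_coef d0 j0 xd hj); lia.
have hxx n : (1 < n <= j + j + 1)%N -> ((h ^ x) ^ x)%g n = h n + k n + (k n + l n).
  move=> nj; have -> : (h ^ x = h * k)%g by rewrite /k commgEl mulKVg.
  rewrite conjMg (mul_low j0 jd0 (sub_conj x hj) (sub_conj x kj)); last by lia.
  by rewrite hx// (conj_comm_coef d0 jd0 xd kj)//; lia.
have hxj := sub_conj x hj; have hxxj := sub_conj x hxj.
have kj1 : k j.+1 = 0 by apply: kj; lia.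
have lj1 : l j.+1 = 0 by apply: lj; lia.
have yE n : (1 < n <= j + j + 1)%N -> ((h ^ x) ^ x * h ^ x * h)%g n = l n.
  move=> nj; rewrite (mul3_coef p3 j0 hxxj hxj hj)//.
  - rewrite hx// hxx//; transitivity (l n + (h n + k n) * 3%:R); first by ring.
    by rewrite p3 mulr0 addr0.
  - by rewrite hxx ?kj1 ?lj1 ?addr0//; lia.
  - by rewrite hx ?kj1 ?addr0//; lia.
split=> [n nj|]; first by rewrite yE ?lj//; lia.
rewrite yE; last by lia.
rewrite -addnn addnA (comm_lead jd0 d0 kj xd) (comm_lead j0 d0 hj xd) natrD; ring.
Qed.

End Cube.

Section SeparationCube.
Local Open Scope ring_scope.
Variable p : nat.
Hypotheses (p_pr : prime p) (p3 : p = 3%N).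
Implicit Types (f g h x y u : nottingham p) (i j n d : nat).

Let three0 : 3%:R = 0 :> 'F_p.
Proof. by apply/eqP; rewrite natFp_eq0// p3. Qed.

Let cube x : (x ^+ 3 = x ^+ p)%g.
Proof. by congr (x ^+ _)%g; rewrite p3. Qed.

Lemma frattini_perturb x u : nott_sub 3 u ->
  coord1 1 (x * u)%g = coord1 1 x /\ coord2 1 (x * u)%g = coord2 1 x.
Proof.
move=> u3; have xu : agree 3 (x * u)%g x.
  by rewrite -{2}[x]mulg1; apply: agreeM => //; exact/sub_agree.
by split; [apply: coord1_agree xu | apply: coord2_agree xu].
Qed.

Lemma cube_perturb_sub x u d j n : (0 < d)%N -> (d.*2 <= j)%N -> nott_sub d x ->
  nott_sub j u -> nott_sub n.+2 (x ^+ p)%g -> (n <= j + d.*2)%N ->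
  nott_sub n ((x * u) ^+ p)%g.
Proof.
move=> d0 dj xd uj xp nj; rewrite -[((x * u) ^+ p)%g](mulKVg (x ^+ p)%g).
apply: sub_mul; first by apply: sub_le xp; lia.
by rewrite -!cube; apply: sub_le nj _; case: (cube_perturb three0 d0 dj xd uj).
Qed.

(** If powers of [x] and [x * u] are conjugate modulo N_n, a suitable power of
    this relation makes [x] conjugate to [x * h], where [h] has the leading
    term of [u]. But then [(x * h)^3] is trivial modulo N_(n+2), against
    [cube_perturb]. *)
Lemma separated_perturb x u d j n : (0 < d)%N -> (d.*2 <= j)%N -> (3 <= j < n)%N ->
  nott_sub d x -> x d.+1 != 0 -> nott_sub j u -> u j.+1 != 0 ->
  j%:R * (j%:R - d%:R) != 0 :> 'F_p -> (n <= j + d.*2 <= n.+1)%N ->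
  (coord1 1 x != 0) || (coord2 1 x != 0) ->
  nott_sub n.+2 (x ^+ p)%g -> separated n x (x * u)%g.
Proof.
move=> d0 dj jn xd x0 uj u0 jd0 njd ab0 xp i i' g xy.
have j3 : nott_sub 3 u by apply: sub_le uj; lia.
have [a1 b1] := frattini_perturb x j3.
have n2 : (2 < n)%N by lia.
have [] := frattini_agree n2 xy; rewrite {}a1 {}b1 => e1 e2.
have ii' : i%:R = i'%:R :> 'F_p.
  by case/orP: ab0 => /mulfI inj; apply: inj.
have xpn : nott_sub n (x ^+ p)%g by apply: sub_le xp; lia.
have xup : nott_sub n ((x * u) ^+ p)%g.
  by apply: (cube_perturb_sub d0 dj) => //; lia.
have [i0|i0] := eqVneq (i%:R : 'F_p) 0; first exact: expg_dvd.
exfalso; have [t tE] := natFp_surj (i%:R^-1 : 'F_p).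
have it : (i * t)%:R = 1 :> 'F_p by rewrite natrM -tE divff.
have i't : (i' * t)%:R = 1 :> 'F_p by rewrite natrM -ii' -natrM.
have {}xy : agree n x ((x * u) ^ g)%g.
  have := agreeX t xy; rewrite -conjXg -!expgnA => E.
  apply: agree_trans (agree_sym (expg_mod p_pr xpn it)) _.
  by apply: agree_trans E _; apply: agreeJ => //; exact: expg_mod.
have xg : agree n (x ^ g^-1)%g (x * u)%g by rewrite -[(x * u)%g](conjgK g); exact: agreeJ.
pose h := (x^-1 * x ^ g^-1)%g.
have hu : agree n h u by rewrite -[u](mulKg x); exact: agreeM.
have hj : nott_sub j h.
  by apply: agree_subW uj; apply: agree_sym; apply: agree_le hu; lia.
have [_] := cube_perturb three0 d0 dj xd hj.
rewrite !cube /h mulKVg -conjXg hu; last by lia.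
have -> : ncoef ((x ^+ p)^-1 * (x ^+ p) ^ g^-1)%g (j + d.*2).+1 = 0.
  have xpp : nott_sub n.+2 ((x ^+ p)^-1 * (x ^+ p) ^ g^-1)%g.
    by apply: sub_mul; [exact: sub_inv | exact: sub_conj].
  by apply: xpp; lia.
by move/esym/eqP; apply/negP; apply: mulf_neq0 => //; apply: mulf_neq0 => //; exact: expf_neq0.
Qed.

End SeparationCube.

(** * Beauville structures of a quotient, in terms of the group *)

Section QuotientBeauville.
Local Open Scope group_scope.
Local Open Scope quotient_scope.
Variables (G : groupType) (N : fin_normal G).
Implicit Types (x y : G) (i j : nat).

Let W := fn_set N.
Let proj x : quot N := \pi_(quot N) x.

Lemma projM x y : proj (x * y) = proj x * proj y.
Proof. exact: pi_quotM. Qed.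

Lemma projV x : proj x^-1 = (proj x)^-1.
Proof. exact: pi_quotV. Qed.

Lemma proj1 : proj 1 = 1.
Proof. by []. Qed.

Lemma projX x i : proj (x ^+ i) = proj x ^+ i.
Proof. by elim: i => // i IH; rewrite !expgS projM IH. Qed.

Lemma projJ x y : proj (x ^ y) = proj x ^ proj y.
Proof. by rewrite !conjgE !projM projV. Qed.

Lemma projK (a : quot N) : proj (repr a) = a.
Proof. exact: reprK. Qed.

Lemma projP x y : proj x = proj y <-> W (x^-1 * y).
Proof. exact: (Defs.quotP N x y). Qed.

Lemma proj_eq1 x : proj x = 1 <-> W x.
Proof.
split=> [E|Wx]; first by have /projP := esym E; rewrite invg1 mul1g.
by apply/esym; rewrite -proj1; apply/projP; rewrite invg1 mul1g.
Qed.

Lemma generate_quotP x y :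
  <<[set proj x; proj y]>> = [set: quot N] <->
  (forall H : set G, is_subgroup H -> (forall g, W g -> H g) -> H x -> H y ->
     forall g, H g).
Proof.
split=> [gen H [H1 HM HV] WH Hx Hy g|gen]; last first.
  apply/setP => a; rewrite inE -(projK a).
  pose H : set G := fun g => proj g \in <<[set proj x; proj y]>>.
  suff : forall g, H g by apply.
  apply: gen.
  - split=> [|u v|u]; rewrite /H; [exact: group1 | rewrite projM; exact: groupM |].
    by rewrite projV groupV.
  - by move=> u /proj_eq1 pu; rewrite /H pu; exact: group1.
  - by rewrite /H mem_gen// !inE eqxx.
  - by rewrite /H mem_gen// !inE eqxx orbT.
have Hproj u v : proj u = proj v -> H u -> H v.
  by move=> /projP uv Hu; rewrite -[v](mulKVg u); apply: (HM) => //; exact: WH.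
pose A := [set a : quot N | `[< H (repr a) >]]%SET.
have gA : group_set A.
  apply/group_setP; split=> [|a b].
    by rewrite inE; apply/asboolP/(Hproj 1) => //; rewrite projK.
  rewrite !finset.in_set => /asboolP Ha /asboolP Hb; apply/asboolP.
  have Hab := HM _ _ Ha Hb; apply: Hproj Hab.
  by rewrite projK projM !projK.
have : <<[set proj x; proj y]>> \subset Group gA.
  rewrite gen_subG; apply/fintype.subsetP => a; rewrite finset.in_set2 /= => /orP[]/eqP ->;
    rewrite finset.in_set; apply/asboolP.
    by apply: Hproj Hx; rewrite projK.
  by apply: Hproj Hy; rewrite projK.
rewrite gen => /fintype.subsetP/(_ (proj g) (finset.in_setT _)); rewrite finset.in_set => /asboolP.
by apply: Hproj; rewrite projK.
Qed.

Lemma Sigma_quotP x y (a : quot N) :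
  reflect (exists z i g, z \in [:: x; y; x * y] /\ a = proj ((z ^+ i) ^ g))
    (a \in Sigma [set: quot N]%G (proj x) (proj y)).
Proof.
apply: (iffP bigcupP) => [[b _]|[z [i [g [zxy ->]]]]].
  rewrite !inE -(projK b) -projM !mem_conjg -projV.
  set c := repr b => /orP[/orP[]|] /cycleP[i E]; [exists x|exists y|exists (x * y)];
    by exists i, c; rewrite !inE eqxx ?orbT; split=> //; rewrite projJ projX -E projV conjgKV.
exists (proj g); first by rewrite inE.
by rewrite projJ projX !inE !memJ_conjg -projM; move: zxy; rewrite !inE =>
  /or3P[]/eqP->; rewrite mem_cycle ?orbT.
Qed.

(** In the quotient, the conjugates of the groups generated by [x] and [y] meet
    trivially. *)
Definition apart x y := forall i j g, W ((x ^+ i)^-1 * (y ^+ j) ^ g) -> W (x ^+ i).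

Lemma beauville_quotP x1 y1 x2 y2 :
  beauville_structure [set: quot N]%G (proj x1) (proj y1) (proj x2) (proj y2) <->
  [/\ <<[set proj x1; proj y1]>> = [set: quot N],
      <<[set proj x2; proj y2]>> = [set: quot N] &
      forall x y, x \in [:: x1; y1; x1 * y1] -> y \in [:: x2; y2; x2 * y2] -> apart x y].
Proof.
split=> -[g1 g2 S]; split=> //.
  move=> x y xx yy i j g /projP E; apply/proj_eq1/set1gP; rewrite -S inE.
  apply/andP; split; apply/Sigma_quotP.
    by exists x, i, 1; rewrite conjg1.
  by exists y, j, g.
apply/setP => a; rewrite !inE; apply/andP/eqP => [[/Sigma_quotP[x [i [g [xx aE]]]]]|->].
  case/Sigma_quotP => y [j [h [yy]]]; rewrite {}aE => /(congr1 (conjg^~ (proj g^-1))).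
  rewrite -!projJ conjgK -conjgM => /projP /(S _ _ xx yy) /proj_eq1 E.
  by rewrite projJ E conj1g.
by split; apply/Sigma_quotP; [exists x1|exists x2]; exists 0, 1; rewrite inE eqxx conj1g.
Qed.

Lemma is_beauville_quotP : is_beauville [set: quot N]%G <->
  exists x1 y1 x2 y2, beauville_structure [set: quot N]%G
    (proj x1) (proj y1) (proj x2) (proj y2).
Proof.
split=> [[a [b [c [d]]]]|[x1 [y1 [x2 [y2 S]]]]].
  by exists (repr a), (repr b), (repr c), (repr d); rewrite !projK.
by exists (proj x1), (proj y1), (proj x2), (proj y2).
Qed.

End QuotientBeauville.

(** * Commutators of low depth *)

Section SmallCommutators.
Local Open Scope ring_scope.
Variable p : nat.
Implicit Types (f g h x y z : nottingham p).

(** The commutator induces the symplectic form of the plane N/N_3, with values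
    in N_3/N_4. *)
Lemma comm_symplectic x y : nott_sub 3 [~ x, y]%g /\
  [~ x, y]%g 4%N = coord1 1 y * coord2 1 x - coord1 1 x * coord2 1 y.
Proof.
have s1 (z : nottingham p) := @sub_all _ 1 z isT.
have c3 : nott_sub 3 [~ x, y]%g.
  apply: sub_next; first exact: (comm_depth (ltn0Sn 0) (ltn0Sn 0) (s1 x) (s1 y)).
  by rewrite (comm_lead (i := 1) (j := 1) _ _ (s1 x) (s1 y))// subrr mul0r.
split=> //; rewrite commgE in c3 *; have /agree_sub xy := c3.
have := agree_div_mid (ltn0Sn 2) xy.
rewrite (mul_high (ltn0Sn 0) (ltn0Sn 0) (s1 x) (s1 y)).
rewrite (mul_high (ltn0Sn 0) (ltn0Sn 0) (s1 y) (s1 x)).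
set c := ncoef (_^-1 * _)%g _; rewrite !eqxx !mulr1n /coord1 /coord2 eqxx !mulr1n => E.
apply: (addrI (y (1 + 1 + 2)%N + x (1 + 1 + 2)%N + (y 2%N * (x 3%N *+ 2 + x 2%N ^+ 2)
  + y 3%N * (x 2%N *+ 3)))).
by rewrite -E; ring.
Qed.

(** In characteristic 3, commuting with an element of depth 3 maps the slope
    c of [x] to the slope -c in the diamond of depth 4. *)
Lemma comm_depth3 x z : 3%:R = 0 :> 'F_p -> nott_sub 3 z ->
  [/\ nott_sub 4 [~ x, z]%g, coord1 4 [~ x, z]%g = coord1 1 x * z 4%N
    & coord2 4 [~ x, z]%g = - (coord2 1 x * z 4%N)].
Proof.
move=> three0 z3; have x1 := @sub_all _ 1 x isT.
have c4 : nott_sub 4 [~ x, z]%g := comm_depth (ltn0Sn 0) (ltn0Sn 2) x1 z3.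
have c5 : [~ x, z]%g 5%N = x 2%N * z 4%N.
  rewrite (comm_lead (i := 1) (j := 3) _ _ x1 z3)// three0; ring.
split; [by [] | exact: c5 |].
rewrite /coord2 mulr0n subr0 commgE in c4 c5 *; have /agree_sub xz := c4.
have := agree_div_high (ltn0Sn 3) xz.
rewrite (mul_high (ltn0Sn 0) (ltn0Sn 2) x1 z3) (mul_high (ltn0Sn 2) (ltn0Sn 0) z3 x1).
rewrite c5 (_ : (z * x)%g 2%N = x 2%N); last first.
  by rewrite (mul_low (ltn0Sn 2) (ltn0Sn 0) z3 x1)// z3// add0r.
set c := ncoef (_^-1 * _)%g _; rewrite !mulr0n !mulr1n (_ : 'C(4, 2) = 6)// => E.
have {}E : c + (x 3%N - x 2%N ^+ 2) * z 4%N = 3%:R * (- x 2%N * (z 5%N + 3%:R * x 2%N * z 4%N)).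
  apply: (addrI (z 6%N + x 6%N + (z 4%N * (x 3%N *+ 4 + x 2%N ^+ 2 *+ 6) + z 5%N * (x 2%N *+ 5))
    + x 2%N * (x 2%N * z 4%N *+ 2))).
  transitivity (z 6%N + x 6%N + (z 4%N * (x 3%N *+ 4 + x 2%N ^+ 2 *+ 6) + z 5%N * (x 2%N *+ 5))
    + c + x 2%N * (x 2%N * z 4%N *+ 2) + (x 3%N - x 2%N ^+ 2) * z 4%N); first by ring.
  rewrite -E; ring.
by move: E; rewrite three0 mul0r => /eqP; rewrite addr_eq0 => /eqP.
Qed.
End SmallCommutators.

(** * Generating pairs of N *)

Section Existence.
Local Open Scope ring_scope.
Variable p : nat.
Implicit Types (f g h x y u : nottingham p) (i j n d : nat).

Lemma exists_co d (a b : 'F_p) : (0 < d)%N ->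
  exists f : nottingham p, [/\ nott_sub d f, coord1 d f = a & coord2 d f = b].
Proof.
move=> d0; pose c i : 'F_p := if i == 1%N then 1 else if i == d.+1 then a else
  if i == d.+2 then b + a ^+ 2 *+ (d == 1%N) else 0.
have cP : (c 0%N == 0) && (c 1%N == 1) by rewrite /c /= !eqxx.
exists (Nottingham cP); split.
- by move=> i id; rewrite /= /c !ifF//; lia.
- by rewrite /coord1 /= /c ifF ?eqxx//; lia.
- rewrite /coord2 /= (_ : c d.+2 = b + a ^+ 2 *+ (d == 1%N)); last first.
    by rewrite /c eqxx !ifF//; lia.
  have [d1|_] := eqVneq d 1%N; last by rewrite !mulr0n addr0 subr0.
  by rewrite !mulr1n /c d1 addrK.
Qed.

Hypotheses (p_pr : prime p) (p_odd : odd p).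

Lemma generation_indep (H : set (nottingham p)) x y n : is_subgroup H ->
  H x -> H y -> frattini_indep x y -> (forall g, nott_sub n g -> H g) ->
  forall g, H g.
Proof.
move=> gH Hx Hy; rewrite /frattini_indep -subr_eq0.
set D := _ - _ => D0 Hn; have [H1 HM HV] := gH.
have HX z k : H z -> H (z ^+ k)%g.
  by move=> Hz; elim: k => // k IH; rewrite expgS; exact: HM.
have s1 (z : nottingham p) := @sub_all _ 1 z isT.
have solve (a b : 'F_p) : exists f, [/\ H f, coord1 1 f = a & coord2 1 f = b].
  have [i iE] := natFp_surj ((a * coord2 1 y - b * coord1 1 y) / D).
  have [j jE] := natFp_surj ((b * coord1 1 x - a * coord2 1 x) / D).
  exists (x ^+ i * y ^+ j)%g; split; first by apply: HM; exact: HX.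
    rewrite coord1M// !coord1X// -[coord1 1 x *+ i]mulr_natr -[coord1 1 y *+ j]mulr_natr -iE -jE.
    apply: (mulIf D0); rewrite mulrDl !mulrA !mulfVK// /D; ring.
  rewrite coord2M// !coord2X// -[coord2 1 x *+ i]mulr_natr -[coord2 1 y *+ j]mulr_natr -iE -jE.
  apply: (mulIf D0); rewrite mulrDl !mulrA !mulfVK// /D; ring.
have [f [Hf f1 f2]] := solve 1 0; have [h [Hh h1 h2]] := solve 0 1.
apply: (generation p_pr p_odd gH Hf _ Hh _ _ Hn).
- by rewrite -[f 2%N]/(coord1 1 f) f1 oner_eq0.
- exact: sub_next.
- by move: h2; rewrite /coord2 -[h 2%N]/(coord1 1 h) h1 expr0n mul0rn subr0 => ->; rewrite oner_eq0.
Qed.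

End Existence.

(** * The two exceptional subgroups of a distinguished diamond *)

Section Distinguished.
Local Open Scope ring_scope.
Variables (p K m : nat).
Hypothesis zK : zdist p m = K.+1.
Implicit Types (f x y : nottingham p).

Lemma nott_sub_zdist f : (0 < K)%N -> nott_sub (zdist p m) f <-> nott_sub K f /\ coord1 K f = 0.
Proof.
move=> K0; rewrite zK; split=> [fK|[fK f0]]; last exact: sub_next.
by split; [exact: sub_le fK | apply: fK; lia].
Qed.

Lemma special_elt_co : (1 < K)%N ->
  [/\ nott_sub K (special_elt p m), coord1 K (special_elt p m) = 1
    & coord2 K (special_elt p m) = 0].
Proof.
move=> K1; split.
- move=> i iK; rewrite /= /special_series zK.
  have [-> ->] : (i == 1%N) = false /\ (i == K.+1) = false by lia.
  by rewrite addr0.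
- by rewrite /coord1 /= /special_series zK eqxx eqSS gtn_eqF ?add0r//; lia.
rewrite /coord2 gtn_eqF// mulr0n subr0 /= /special_series zK.
have [-> ->] : (K.+2 == 1%N) = false /\ (K.+2 == K.+1) = false by lia.
by rewrite addr0.
Qed.

Lemma gen_special f : prime p -> (1 < K)%N ->
  gen_subgroup ([set special_elt p m] `|` nott_sub (zdist p m + 1))%classic f <->
  nott_sub K f /\ coord2 K f = 0.
Proof.
move=> p_pr K1; have [eK e1 e2] := special_elt_co K1; have K0 := ltnW K1.
have zK2 : (zdist p m + 1 = K.+2)%N by rewrite zK addn1.
rewrite /gen_subgroup zK2; split=> [gen|[fK f0]].
  apply: (gen (fun f => nott_sub K f /\ coord2 K f = 0)); split.
    split=> [|x y [xK x0] [yK y0]|x [xK x0]].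
    - by split; [exact: sub_one | exact: coord2_one].
    - by split; [exact: sub_mul | rewrite coord2M// x0 y0 addr0].
    - by split; [exact: sub_inv | rewrite coord2V// x0 oppr0].
  move=> x [->|x2] //; split; first by apply: sub_le x2; lia.
  by rewrite (coord2_agree _ ((sub_agree _ _).1 x2)) ?coord2_one.
move=> H [[H1 HM HV] sub].
have He : H (special_elt p m) by apply: sub; left.
have HX n : H (special_elt p m ^+ n)%g.
  by elim: n => // n IH; rewrite expgS; exact: HM.
have [n nE] := natFp_surj (coord1 K f).
rewrite -[f](mulKVg (special_elt p m ^+ n)%g); apply: (HM) => //.
apply: sub; right; apply/agree_sub/agree_co => //; first exact: sub_exp.
  by rewrite coord1X// e1 -nE.
by rewrite coord2X// e2 f0 mul0rn.
Qed.

End Distinguished.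

(** * Quotients by an intermediate subgroup of a diamond *)

Section Diamond.
Local Open Scope ring_scope.
Variables (p k : nat) (W : set (nottingham p)).
Hypotheses (p_pr : prime p) (p_odd : odd p) (gW : is_subgroup W).
Hypotheses (ltW : (nott_sub (k * p + 3) `<` W)%classic).
Hypotheses (Wlt : (W `<` nott_sub (k * p + 1))%classic).
Implicit Types (f g h x y u : nottingham p) (i j n d : nat).

Let K := (k * p + 1)%N.

Let p_gt2 : (2 < p)%N := odd_prime_gt2 p_odd p_pr.

Lemma diamond_mod : K%:R = 1 :> 'F_p.
Proof. by rewrite natrD natrM natFp_p// mulr0 add0r. Qed.

Let K0 : (0 < K)%N. Proof. by rewrite /K addn1. Qed.

Lemma diamond_bottom f : nott_sub K.+2 f -> W f.
Proof. by case: ltW => sub _ fK; apply: sub; rewrite [(k * p + 3)%N](_ : _ = K.+2)//; rewrite /K; lia. Qed.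

Lemma diamond_top f : W f -> nott_sub K f.
Proof. by case: Wlt => sub _; exact: sub. Qed.

Let W1 : W 1%g. Proof. by case: gW. Qed.
Let WM f g : W f -> W g -> W (f * g)%g. Proof. by case: gW => _ + _; apply. Qed.
Let WV f : W f -> W f^-1%g. Proof. by case: gW => _ _; apply. Qed.
Let WX f n : W f -> W (f ^+ n)%g.
Proof. by move=> Wf; elim: n => // n IH; rewrite expgS; exact: WM. Qed.

Lemma diamond_agree f g : agree K.+2 f g -> W f -> W g.
Proof.
move=> fg Wf; rewrite -[g](mulKVg f); apply: WM => //.
exact/diamond_bottom/agree_sub.
Qed.

(** An intermediate subgroup is the line of the plane N_K/N_(K+2) spanned by
    any of its elements outside N_(K+2). *)
Lemma diamond_line : exists A B : 'F_p, (A != 0) || (B != 0) /\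
  forall f, W f <-> nott_sub K f /\ A * coord2 K f = B * coord1 K f.
Proof.
have [w Ww wK] : exists2 w, W w & ~ nott_sub K.+2 w.
  apply: contrapT => no; case: ltW => _; apply => f Wf.
  apply: contrapT => fK; apply: no; exists f => // fK2; apply: fK.
  by rewrite [(k * p + 3)%N](_ : _ = K.+2)// /K; lia.
have wd := diamond_top Ww.
exists (coord1 K w), (coord2 K w); split.
  apply: contrapT => /negP; rewrite negb_or !negbK => /andP[/eqP w1 /eqP w2].
  by apply: wK; exact: sub_co.
move=> f; split=> [Wf|[fK fw]].
  split; first exact: diamond_top.
  have fK := diamond_top Wf.
  apply: contrapT => /eqP; rewrite -subr_eq0; set D := _ - _ => D0.
  case: Wlt => _; apply => g gK.
  have [i iE] := natFp_surj ((coord1 K g * coord2 K f - coord2 K g * coord1 K f) / D).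
  have [j jE] := natFp_surj ((coord2 K g * coord1 K w - coord1 K g * coord2 K w) / D).
  apply: (@diamond_agree (w ^+ i * f ^+ j)%g); last by apply: WM; exact: WX.
  have wi := sub_exp i wd; have fj := sub_exp j fK.
  apply: agree_co => //; first exact: sub_mul.
    rewrite coord1M// !coord1X// -[coord1 K w *+ i]mulr_natr -[coord1 K f *+ j]mulr_natr -iE -jE.
    apply: (mulIf D0); rewrite mulrDl !mulrA !mulfVK// /D; ring.
  rewrite coord2M// !coord2X// -[coord2 K w *+ i]mulr_natr -[coord2 K f *+ j]mulr_natr -iE -jE.
  apply: (mulIf D0); rewrite mulrDl !mulrA !mulfVK// /D; ring.
have wn : (coord1 K w != 0) || (coord2 K w != 0).
  apply: contrapT => /negP; rewrite negb_or !negbK => /andP[/eqP w1 /eqP w2].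
  by apply: wK; exact: sub_co.
have [c [c1 c2]] : exists c, coord1 K w * c = coord1 K f /\ coord2 K w * c = coord2 K f.
  case/orP: wn => w0.
    exists (coord1 K f / coord1 K w); split; first by rewrite mulrCA divff// mulr1.
    by rewrite mulrA -fw mulrAC divff// mul1r.
  exists (coord2 K f / coord2 K w); split; last by rewrite mulrCA divff// mulr1.
  by rewrite mulrA fw mulrAC divff// mul1r.
have [i iE] := natFp_surj c.
apply: (@diamond_agree (w ^+ i)%g); last exact: WX.
apply: agree_co => //; first exact: sub_exp.
  by rewrite coord1X// -mulr_natr -iE.
by rewrite coord2X// -mulr_natr -iE.
Qed.

(** The group N_K/W has order [p]. *)
Lemma diamond_cyclic f g : nott_sub K f -> nott_sub K g -> ~ W g ->
  exists i, W (f^-1 * g ^+ i)%g.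
Proof.
move=> fK gK; have [A [B [_ WE]]] := diamond_line.
move=> Wg; pose L h := A * coord2 K h - B * coord1 K h.
have Lg : L g != 0.
  by apply: contra_notN Wg => /eqP/eqP; rewrite subr_eq0 => /eqP E; apply/WE.
have [i iE] := natFp_surj (L f / L g); exists i.
have fV := sub_inv fK; have gi := sub_exp i gK.
apply/WE; split; first exact: sub_mul.
apply/eqP; rewrite -subr_eq0; apply/eqP.
rewrite coord1M// coord2M// coord1V// coord2V// coord1X// coord2X//.
rewrite -[coord1 K g *+ i]mulr_natr -[coord2 K g *+ i]mulr_natr -iE.
transitivity (L g * (L f / L g) - L f); first by rewrite /L; ring.
by rewrite mulrCA divff// mulr1 subrr.
Qed.

Definition diamond_fin_normal :=
  FinNormal (diamond_normal p_pr gW ltW Wlt) (diamond_index ltW).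

(** Restatement without the quotient; generation of the quotient is expressed
    by the subgroups of N that contain W. *)
Lemma is_beauville_diamondP :
  is_beauville [set: diamond_quot p_pr gW ltW Wlt]%G <->
  exists x1 y1 x2 y2,
    [/\ (forall H, is_subgroup H -> (forall g, W g -> H g) -> H x1 -> H y1 -> forall g, H g),
        (forall H, is_subgroup H -> (forall g, W g -> H g) -> H x2 -> H y2 -> forall g, H g)
      & forall x y, x \in [:: x1; y1; x1 * y1]%g -> y \in [:: x2; y2; x2 * y2]%g ->
          apart diamond_fin_normal x y].
Proof.
split=> [/(@is_beauville_quotP _ diamond_fin_normal) [x1 [y1 [x2 [y2]]]]|].
  move=> /beauville_quotP[/generate_quotP g1 /generate_quotP g2 S].
  by exists x1, y1, x2, y2.
move=> [x1 [y1 [x2 [y2 [g1 g2 S]]]]]; apply/(@is_beauville_quotP _ diamond_fin_normal).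
exists x1, y1, x2, y2; apply/beauville_quotP.
by split=> //; exact/generate_quotP.
Qed.

(** If the images in N/N_3 are dependent, the kernel of a linear form that
    vanishes on them is a proper subgroup. Here [k > 0] ensures that W is
    contained in N_3. *)
Lemma generate_indep x y : (0 < k)%N ->
  (forall H, is_subgroup H -> (forall g, W g -> H g) -> H x -> H y -> forall g, H g) <->
  frattini_indep x y.
Proof.
move=> k0; split=> [gen|indep H gH WH Hx Hy]; last first.
  by apply: (generation_indep p_pr p_odd gH Hx Hy indep (n := K.+2)) => g /diamond_bottom/WH.
have s1 (z : nottingham p) := @sub_all _ 1 z isT.
have kernel (a b : 'F_p) : a * coord1 1 x + b * coord2 1 x = 0 ->
    a * coord1 1 y + b * coord2 1 y = 0 -> a = 0 /\ b = 0.
  move=> xH yH; pose H : set (nottingham p) := fun g => a * coord1 1 g + b * coord2 1 g = 0.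
  have gH : is_subgroup H.
    split=> [|f g|f]; rewrite /H.
    - by rewrite coord1_one// coord2_one !mulr0 addr0.
    - by move=> Hf Hg; rewrite coord1M// coord2M// (mulrDr a) (mulrDr b) addrACA Hf Hg addr0.
    - by move=> Hf; rewrite coord1V// coord2V// !mulrN -opprD Hf oppr0.
  have WH f : W f -> H f.
    move=> /diamond_top fK; have f3 : agree 3 f 1%g.
      by apply/sub_agree/(sub_le _ fK); rewrite /K; nia.
    by rewrite /H (coord1_agree _ f3)// (coord2_agree _ f3)// coord1_one// coord2_one !mulr0 addr0.
  have all := gen H gH WH xH yH; split.
    have [f [_ f1 f2]] := exists_co (1 : 'F_p) 0 (ltn0Sn 0).
    by have := all f; rewrite /H f1 f2 mulr1 mulr0 addr0.
  have [f [_ f1 f2]] := exists_co (0 : 'F_p) 1 (ltn0Sn 0).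
  by have := all f; rewrite /H f1 f2 mulr1 mulr0 add0r.
apply/eqP => E.
have [x2 x1] : coord2 1 x = 0 /\ - coord1 1 x = 0.
  by apply: kernel; [ring | rewrite mulNr E; ring].
have {}x1 : coord1 1 x = 0 by apply/eqP; rewrite -oppr_eq0 x1.
have [y2 y1] : coord2 1 y = 0 /\ - coord1 1 y = 0.
  by apply: kernel; [rewrite x1 x2; ring | ring].
have {}y1 : coord1 1 y = 0 by apply/eqP; rewrite -oppr_eq0 y1.
have [/eqP] : (1 : 'F_p) = 0 /\ (0 : 'F_p) = 0.
  by apply: kernel; rewrite ?x1 ?x2 ?y1 ?y2; ring.
by rewrite oner_eq0.
Qed.

Lemma diamond_lt_step d : d%:R = 1 :> 'F_p -> (K < d)%N -> (K.+2 <= d)%N.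
Proof.
move=> d1 Kd; suff : (p %| d - K)%N by move=> /dvdn_leq; lia.
by rewrite -natFp_eq0// natrB ?diamond_mod ?d1 ?subrr// ltnW.
Qed.

(** This and the next lemma say that for members of the first triple,
    triviality modulo N_K already gives triviality modulo W. A power of [x]
    that lies in N_K has either greater depth than the diamond, or it lies in
    the diamond, on the line of slope [s]. *)
Lemma absorb_slope s x : coord1 1 x != 0 -> coord2 1 x != 0 -> coord2 1 x = s * coord1 1 x ->
  (forall l f, (zdist p l - 1)%N = K -> nott_sub K f -> coord2 K f = s * coord1 K f -> W f) ->
  forall i, nott_sub K (x ^+ i)%g -> W (x ^+ i)%g.
Proof.
move=> a0 b0 xs sW [//|i] xK.
have [l [xd x0 xl]] := slope_exp p_pr p_odd a0 b0 (ltn0Sn i).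
case: (ltngtP (zdist p l - 1)%N K) => dK.
- by move: x0; rewrite /coord1 xK ?eqxx//; have := zdist_gt0 p l; lia.
- exact/diamond_bottom/(sub_le (diamond_lt_step (zdist_mod p_pr l) dK)).
apply: (sW l) => //; rewrite dK in xl.
by apply: (mulfI a0); rewrite xl xs; ring.
Qed.

Lemma absorb_order_p x : (0 < k)%N -> nott_sub K.+2 (x ^+ p)%g ->
  (coord1 1 x != 0) || (coord2 1 x != 0) ->
  forall i, nott_sub K (x ^+ i)%g -> W (x ^+ i)%g.
Proof.
move=> k0 xp x0 i xK; have x1 := @sub_all _ 1 x isT.
apply/diamond_bottom/expg_dvd => //.
have x3 : agree 3 (x ^+ i)%g 1%g by apply/sub_agree/(sub_le _ xK); rewrite /K; nia.
case/orP: x0 => x0; apply: (mulfI x0); rewrite mulr0 mulr_natr.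
  by rewrite -coord1X// (coord1_agree _ x3)// coord1_one.
by rewrite -coord2X// (coord2_agree _ x3)// coord2_one.
Qed.

Lemma beauville_of_separated x1 y1 x2 y2 : (0 < k)%N ->
  frattini_indep x1 y1 -> frattini_indep x2 y2 ->
  (forall x, x \in [:: x1; y1; x1 * y1]%g ->
     forall i, nott_sub K (x ^+ i)%g -> W (x ^+ i)%g) ->
  (forall x y, x \in [:: x1; y1; x1 * y1]%g -> y \in [:: x2; y2; x2 * y2]%g ->
     separated K x y) ->
  is_beauville [set: diamond_quot p_pr gW ltW Wlt]%G.
Proof.
move=> k0 g1 g2 absorb sep; apply/is_beauville_diamondP; exists x1, y1, x2, y2.
split; [exact/generate_indep | exact/generate_indep |].
move=> x y xx yy i j g /diamond_top/agree_sub xy.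
by apply: absorb => //; exact: sep xy.
Qed.

(** The slope of [t] need not be computed: by [exp_p_depth], an element of
    depth 1 whose [p]-th power vanishes to higher order has slope 0. *)
Lemma order_p_pair : (0 < k)%N -> exists t s : nottingham p,
  [/\ coord1 1 t = 1, coord2 1 t = 0, coord1 1 s = 0 & coord2 1 s = 1] /\
  [/\ nott_sub 2 s, nott_sub K.+2 (t ^+ p)%g & nott_sub K.+2 (s ^+ p)%g].
Proof.
move=> k0; have [||t [t1 t2 tp]] := @exists_order_p p p_pr 1 K.+2.
- by rewrite prime_gt1.
- exact: dvd1n.
have [||s [s2 s3 sp]] := @exists_order_p p p_pr 2 K.+2.
- exact: p_gt2.
- by rewrite dvdn2; move: (p_pr) p_odd; case: (p) => // q _ /=.
exists t, s; split; split=> //.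
- have [_] := exp_p_depth p_pr p_odd (ltn0Sn 0) (erefl : 1%:R = 1 :> 'F_p) t1.
  rewrite {2}/coord1 t2 expr1n mulN1r => E.
  apply/eqP; rewrite -oppr_eq0 -E /coord1 tp//; rewrite /K; nia.
- by rewrite /coord1 s2.
- by rewrite /coord2 s3 s2// expr0n mul0rn subr0.
Qed.

Let psi1M x y : coord1 1 (x * y)%g = coord1 1 x + coord1 1 y.
Proof. by apply: coord1M => //; exact: sub_all. Qed.
Let psi2M x y : coord2 1 (x * y)%g = coord2 1 x + coord2 1 y.
Proof. by apply: coord2M => //; exact: sub_all. Qed.
Let psi1X x n : coord1 1 (x ^+ n)%g = coord1 1 x * n%:R.
Proof. by rewrite mulr_natr; apply: coord1X => //; exact: sub_all. Qed.
Let psi2X x n : coord2 1 (x ^+ n)%g = coord2 1 x * n%:R.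
Proof. by rewrite mulr_natr; apply: coord2X => //; exact: sub_all. Qed.

(** The first triple has slopes 0, infinity and [s]; the second [- s], [2 s]
    and [s / 2]. The latter pair generates because [3] is not 0. *)
Lemma beauville_gt3 (s : 'F_p) : (0 < k)%N -> (3 < p)%N -> s != 0 ->
  (forall l f, (zdist p l - 1)%N = K -> nott_sub K f -> coord2 K f = s * coord1 K f -> W f) ->
  is_beauville [set: diamond_quot p_pr gW ltW Wlt]%G.
Proof.
move=> k0 p3 s0 sW; have [t [u [[t1 t2 u1 u2] [uN tp up]]]] := order_p_pair k0.
have [a aE] := natFp_surj s.
have [b bE] := natFp_surj (- s); have [c cE] := natFp_surj (2%:R * s).
have n2 : 2%:R != 0 :> 'F_p by apply: natFp_neq0.
have n3 : 3%:R != 0 :> 'F_p by apply: natFp_neq0 => //; lia.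
have K2 : (2 < K)%N by rewrite /K; nia.
have upa : nott_sub K.+2 ((u ^+ a) ^+ p)%g by rewrite expgnAC; exact: sub_exp.
pose E := (psi1M, psi2M, psi1X, psi2X, t1, t2, u1, u2, =^~ aE, =^~ bE, =^~ cE).
have nz x y : (coord1 1 x * coord2 1 y - coord2 1 x * coord1 1 y != 0) -> frattini_indep x y.
  by rewrite subr_eq0.
have KK2 f : nott_sub K.+2 f -> nott_sub K f by apply: sub_le; lia.
apply: (@beauville_of_separated t (u ^+ a)%g (t * u ^+ b)%g (t * u ^+ c)%g) => //.
- by apply: nz; rewrite !E (_ : _ - _ = s) //; ring.
- by apply: nz; rewrite !E (_ : _ - _ = 3%:R * s) ?mulf_neq0 //; ring.
- move=> x; rewrite !inE => /or3P[]/eqP ->.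
  + by apply: absorb_order_p; rewrite // t1 oner_eq0.
  + by apply: absorb_order_p; rewrite // !E mul1r s0 orbT.
  + apply: (@absorb_slope s) => //; rewrite !E ?mul0r ?mul1r ?addr0 ?add0r ?mulr1 ?oner_eq0//.
have order_p x y D : nott_sub K (x ^+ p)%g -> D != 0 ->
    coord1 1 x * coord2 1 y - coord2 1 x * coord1 1 y = D -> separated K x y.
  by move=> xp D0 xy; apply: separated_order_p => //; [apply: nz; rewrite xy | left].
have slope x y D : coord1 1 x != 0 -> coord2 1 x != 0 -> coord1 1 y != 0 -> coord2 1 y != 0 -> D != 0 ->
    coord1 1 x * coord2 1 y - coord2 1 x * coord1 1 y = D -> separated K x y.
  move=> x1 x2 y1 y2 D0 xy; apply: separated_slope => //; first exact: diamond_mod.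
  by apply: nz; rewrite xy.
have Ns0 : - s != 0 by rewrite oppr_eq0.
have s20 : 2%:R * s != 0 by rewrite mulf_neq0.
have s2N0 : - (2%:R * s) != 0 by rewrite oppr_eq0.
move=> x y; rewrite !inE => /or3P[]/eqP ->.
- by case/or3P => /eqP ->;
    [apply: (order_p _ _ (- s)) | apply: (order_p _ _ (2%:R * s)) | apply: (order_p _ _ s)];
    rewrite ?E //; [exact: KK2 | ring | exact: KK2 | ring | exact: KK2 | ring].
- by case/or3P => /eqP ->;
    [apply: (order_p _ _ (- s)) | apply: (order_p _ _ (- s)) | apply: (order_p _ _ (- (2%:R * s)))];
    rewrite ?E //; [exact: KK2 | ring | exact: KK2 | ring | exact: KK2 | ring].
have simp := (mul0r, mul1r, addr0, add0r, oner_eq0).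
case/or3P => /eqP ->;
  [apply: (slope _ _ (- (2%:R * s))) | apply: (slope _ _ s) | apply: (slope _ _ (- s))];
  rewrite ?E ?simp //; try ring.
by rewrite (_ : - s + 2%:R * s = s)//; ring.
Qed.
Lemma separatedX n x y a b : separated n x y -> separated n (x ^+ a)%g (y ^+ b)%g.
Proof.
move=> xy i j g; rewrite -(expgnA x) -(expgnA y) => E.
exact: xy E.
Qed.

(** The depths [K - 2] and [K - 3] of the perturbations [h] and [h'] are those
    from which two commutators with elements of depth 1, resp. 2, lead with
    nonzero coefficients into depths [K] and [K + 1] of the last diamond. The
    condition [1 < k] gives [K >= 7], so that both perturbations lie in N_3
    and do not move the slopes. *)
Lemma beauville_3 (s : 'F_p) : p = 3%N -> (1 < k)%N -> s != 0 ->
  (forall l f, (zdist p l - 1)%N = K -> nott_sub K f -> coord2 K f = s * coord1 K f -> W f) ->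
  is_beauville [set: diamond_quot p_pr gW ltW Wlt]%G.
Proof.
move=> p3 k1 s0 sW; have k0 : (0 < k)%N by lia.
have [t [u [[t1 t2 u1 u2] [uN tp up]]]] := order_p_pair k0.
have K7 : (7 <= K)%N by rewrite /K p3; lia.
have [K3 [K2p K3p]] : (2 < K)%N /\ (0 < K - 2)%N /\ (0 < K - 3)%N by lia.
have [jt jtK tK] : [/\ 1.*2 <= K - 2, 3 <= K - 2 < K & K <= (K - 2) + 1.*2 <= K.+1]%N by split; lia.
have [ju juK uK] : [/\ 2.*2 <= K - 3, 3 <= K - 3 < K & K <= (K - 3) + 2.*2 <= K.+1]%N by split; lia.
have [h [hN h1 _]] := exists_co (1 : 'F_p) 0 K2p.
have [h' [hN' h1' _]] := exists_co (1 : 'F_p) 0 K3p.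
have [a aE] := natFp_surj s; have [b bE] := natFp_surj (- s).
have three0 : 3%:R = 0 :> 'F_p by apply/eqP; rewrite natFp_eq0// p3.
have n2 : 2%:R != 0 :> 'F_p by apply: natFp_neq0.
have KK2 f : nott_sub K.+2 f -> nott_sub K f by apply: sub_le; exact: (leqW (leqnSn K)).
have hN3 : nott_sub 3 h by apply: sub_le hN; case/andP: jtK.
have hN3' : nott_sub 3 h' by apply: sub_le hN'; case/andP: juK.
have [th1 th2] := frattini_perturb t hN3.
have [uh1 uh2] := frattini_perturb u hN3'.
rewrite t1 in th1; rewrite t2 in th2; rewrite u1 in uh1; rewrite u2 in uh2.
have u3 : u 3%N != 0.
  move: u2; rewrite /coord2 -[u 2%N]/(coord1 1 u) u1 expr0n mul0rn subr0 => ->.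
  exact: oner_neq0.
have t1N := @sub_all _ 1 t isT.
have thp : nott_sub K ((t * h) ^+ p)%g.
  by apply: (cube_perturb_sub p_pr p3 (ltn0Sn 0) jt t1N hN tp); case/andP: tK.
have uhp : nott_sub K ((u * h') ^+ p)%g.
  by apply: (cube_perturb_sub p_pr p3 (ltn0Sn 1) ju uN hN' up); case/andP: uK.
have upa : nott_sub K.+2 ((u ^+ a) ^+ p)%g by rewrite expgnAC; exact: sub_exp.
have uhpb : nott_sub K (((u * h') ^+ b) ^+ p)%g by rewrite expgnAC; exact: sub_exp.
pose E := (psi1X, psi2X, psi1M t (u ^+ a)%g, psi2M t (u ^+ a)%g,
  psi1M (t * h)%g ((u * h') ^+ b)%g, psi2M (t * h)%g ((u * h') ^+ b)%g,
  t1, t2, u1, u2, th1, th2, uh1, uh2, =^~ aE, =^~ bE).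
have nz x y : (coord1 1 x * coord2 1 y - coord2 1 x * coord1 1 y != 0) -> frattini_indep x y.
  by rewrite subr_eq0.
have Ns0 : - s != 0 by rewrite oppr_eq0.
have s20 : - (2%:R * s) != 0 by rewrite oppr_eq0 mulf_neq0.
have K1 : K%:R = 1 :> 'F_p by rewrite diamond_mod.
have K2E : (K - 2)%:R = -1 :> 'F_p by rewrite natrB ?K1; [ring | exact: ltnW].
have K3E : (K - 3)%:R = 1 :> 'F_p by rewrite natrB ?K1 ?three0 ?subr0//.
have sep_t : separated K t (t * h)%g.
  apply: (separated_perturb p_pr p3 (ltn0Sn 0) jt jtK t1N _ hN _ _ tK _ tp).
  - by rewrite -[t 2%N]/(coord1 1 t) t1 oner_eq0.
  - by rewrite -[h _]/(coord1 (K - 2) h) h1 oner_eq0.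
  - by rewrite K2E (_ : -1 * _ = 2%:R)//; ring.
  - by rewrite t1 oner_eq0.
have sep_u : separated K (u ^+ a)%g ((u * h') ^+ b)%g.
  apply: separatedX.
  apply: (separated_perturb p_pr p3 (ltn0Sn 1) ju juK uN u3 hN' _ _ uK _ up).
  - by rewrite -[h' _]/(coord1 (K - 3) h') h1' oner_eq0.
  - by rewrite K3E (_ : 1 * _ = - 1) ?oppr_eq0 ?oner_eq0//; ring.
  - by rewrite u2 oner_eq0 orbT.
have order_p x y D : nott_sub K (x ^+ p)%g \/ nott_sub K (y ^+ p)%g -> D != 0 ->
    coord1 1 x * coord2 1 y - coord2 1 x * coord1 1 y = D -> separated K x y.
  by move=> xp D0 xy; apply: separated_order_p => //; apply: nz; rewrite xy.
apply: (@beauville_of_separated t (u ^+ a)%g (t * h)%g ((u * h') ^+ b)%g k0).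
- by apply: nz; rewrite !E (_ : _ - _ = s) //; ring.
- by apply: nz; rewrite !E (_ : _ - _ = - s) //; ring.
- move=> x; rewrite !inE => /or3P[]/eqP ->.
  + by apply: absorb_order_p; rewrite // t1 oner_eq0.
  + by apply: absorb_order_p; rewrite // !E mul1r s0 orbT.
  + apply: (@absorb_slope s) => //; rewrite !E ?mul0r ?mul1r ?addr0 ?add0r ?mulr1 ?oner_eq0//.
move=> x y; rewrite !inE => /or3P[]/eqP ->.
- case/or3P => /eqP ->; first exact: sep_t.
  + by apply: (order_p _ _ (- s) (or_introl (KK2 _ tp)) Ns0); rewrite !E; ring.
  + by apply: (order_p _ _ (- s) (or_introl (KK2 _ tp)) Ns0); rewrite !E; ring.
- case/or3P => /eqP ->; last 1 first.
  + by apply: (order_p _ _ (- s) (or_introl (KK2 _ upa)) Ns0); rewrite !E; ring.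
  + by apply: (order_p _ _ (- s) (or_introl (KK2 _ upa)) Ns0); rewrite !E; ring.
  + exact: sep_u.
case/or3P => /eqP ->.
- by apply: (order_p _ _ (- s)) => //; [right | rewrite !E; ring].
- by apply: (order_p _ _ (- s)) => //; [right | rewrite !E; ring].
apply: separated_slope => //; first by apply: nz; rewrite !E (_ : _ - _ = - (2%:R * s)) //; ring.
all: by rewrite !E ?mul0r ?mul1r ?addr0 ?add0r ?oner_eq0.
Qed.
Lemma triple_off_axes x y : frattini_indep x y ->
  exists2 z, z \in [:: x; y; x * y]%g & (coord1 1 z != 0) && (coord2 1 z != 0).
Proof.
rewrite /frattini_indep; move: (psi1M x y) (psi2M x y).
have [x1|x1] := eqVneq (coord1 1 x) 0; have [x2|x2] := eqVneq (coord2 1 x) 0;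
  have [y1|y1] := eqVneq (coord1 1 y) 0; have [y2|y2] := eqVneq (coord2 1 y) 0;
  rewrite ?x1 ?x2 ?y1 ?y2 ?mul0r ?mulr0 ?eqxx ?add0r ?addr0 // => e1 e2 _;
  try (by exists x; rewrite ?inE ?eqxx ?x1 ?x2); try (by exists y; rewrite ?inE ?eqxx ?orbT ?y1 ?y2);
  by exists (x * y)%g; rewrite ?inE ?eqxx ?orbT ?e1 ?e2 ?x1 ?x2 ?y1 ?y2.
Qed.

(** Both triples contain an element of slope neither 0 nor infinite
    ([triple_off_axes]), and its [p^m]-th power generates N_K/W. *)
Lemma not_beauville_axis m : (0 < k)%N -> (zdist p m - 1)%N = K ->
  (forall f, W f -> coord1 K f = 0 \/ coord2 K f = 0) ->
  ~ is_beauville [set: diamond_quot p_pr gW ltW Wlt]%G.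
Proof.
move=> k0 mK axis /is_beauville_diamondP[x1 [y1 [x2 [y2]]]].
move=> -[/(generate_indep _ _ k0) g1 /(generate_indep _ _ k0) g2 ap].
have [x xx /andP[x10 x20]] := triple_off_axes g1.
have [y yy /andP[y10 y20]] := triple_off_axes g2.
have power z : coord1 1 z != 0 -> coord2 1 z != 0 ->
    nott_sub K (z ^+ (p ^ m))%g /\ ~ W (z ^+ (p ^ m))%g.
  move=> z1 z2; have [zK c0 cs] := slope_exp_p p_pr p_odd m z1 z2.
  rewrite mK in zK c0 cs; split=> // /axis[] E; first by rewrite E eqxx in c0.
  by move: cs; rewrite E mulr0 => /esym/eqP; rewrite mulf_eq0 (negPf c0) (negPf z2).
have [xK xW] := power x x10 x20; have [yK yW] := power y y10 y20.
have [i Wi] := diamond_cyclic xK yK yW.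
apply: xW; apply: (ap _ _ xx yy (p ^ m)%N (p ^ m * i)%N 1%g).
by rewrite conjg1 expgnA.
Qed.

Lemma not_beauville_first : k = 0%N -> ~ is_beauville [set: diamond_quot p_pr gW ltW Wlt]%G.
Proof.
move=> k0 /is_beauville_diamondP[x1 [y1 [x2 [y2 [g1 g2 ap]]]]].
have NK f : nott_sub K f by rewrite /K k0; exact: sub_all.
have proper x y : (forall H, is_subgroup H -> (forall g, W g -> H g) -> H x -> H y ->
    forall g, H g) -> exists2 z, z \in [:: x; y; x * y]%g & ~ W z.
  move=> gen; apply: contrapT => no.
  have all z : z \in [:: x; y; x * y]%g -> W z.
    by move=> zz; apply: contrapT => zW; apply: no; exists z.
  case: Wlt => _; apply => g _; apply: gen => //; apply: all;
    by rewrite !inE eqxx ?orbT.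
have [x xx xW] := proper _ _ g1; have [y yy yW] := proper _ _ g2.
have [i Wi] := diamond_cyclic (NK x) (NK y) yW.
by apply: xW; have := ap _ _ xx yy 1%N i 1%g; rewrite conjg1 expg1; apply.
Qed.

(** Let the line W have slope [B/A]. The elements congruent to [x] modulo N_3
    are reached by conjugation in two steps: [comm_symplectic] moves the
    coefficient of degree 4 at will, and commutators with elements of depth 3,
    whose slope is opposite to that of [x], fill N_4/W unless [x] has slope
    [- B/A]. *)
Lemma conj_class_mod (A B : 'F_p) x y : p = 3%N -> k = 1%N ->
  (forall f, W f <-> nott_sub K f /\ A * coord2 K f = B * coord1 K f) ->
  coord1 1 x = coord1 1 y -> coord2 1 x = coord2 1 y -> A * coord2 1 x + B * coord1 1 x != 0 ->
  exists g, W ((x ^ g)^-1 * y)%g.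
Proof.
move=> p3 k1 WE xy1 xy2 L0; have K4 : K = 4%N by rewrite /K k1 p3.
have three0 : 3%:R = 0 :> 'F_p by apply/eqP; rewrite natFp_eq0// p3.
have K1 : K%:R = 1 :> 'F_p by rewrite diamond_mod.
have s1 (z : nottingham p) := @sub_all _ 1 z isT.
have h3 : nott_sub 3 (x^-1 * y)%g by apply/agree_sub; apply: agree_co (s1 x) (s1 y) _ _.
(* first match the coefficient of degree 4, then the coset of W *)
have [q qE] : exists q, [~ x, q]%g 4%N = (x^-1 * y)%g 4%N.
  have x0 : (coord1 1 x != 0) || (coord2 1 x != 0).
    by apply: contraNT L0; rewrite negb_or !negbK => /andP[/eqP-> /eqP->]; rewrite !mulr0 addr0.
  have [q1 [q2 qq]] : exists q1 q2, q1 * coord2 1 x - coord1 1 x * q2 = (x^-1 * y)%g 4%N.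
    case/orP: x0 => x0.
      exists 0, (- ((x^-1 * y)%g 4%N / coord1 1 x)).
      by rewrite mul0r add0r mulrN opprK mulrCA divff// mulr1.
    by exists ((x^-1 * y)%g 4%N / coord2 1 x), 0; rewrite mulr0 subr0 mulfVK.
  have [q [_ E1 E2]] := exists_co q1 q2 (ltn0Sn 0).
  by exists q; case: (comm_symplectic x q) => _ ->; rewrite E1 E2.
have [c3 _] := comm_symplectic x q.
pose r := ((x ^ q)^-1 * y)%g.
have rK : nott_sub K r.
  rewrite K4 /r (_ : (x ^ q)^-1 * y = [~ x, q]^-1 * (x^-1 * y))%g; last first.
    by rewrite commgEl (invgM x^-1%g) invgK -mulgA mulKVg.
  apply: sub_next; first by apply: sub_mul => //; exact: sub_inv.
  rewrite -[LHS]/(coord1 3 _) coord1M//; last exact: sub_inv.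
  by rewrite coord1V// /coord1 qE addNr.
pose L f := A * coord2 K f - B * coord1 K f.
have [z [z3 z4 _]] := exists_co (- (L r / (A * coord2 1 x + B * coord1 1 x))) 0 (ltn0Sn 2).
have [c4 c5 c6] := comm_depth3 x three0 z3.
rewrite -[z 4%N]/(coord1 3 z) in c5 c6; rewrite -K4 in c4 c5 c6.
exists (z * q)%g; apply/WE.
have E : ((x ^ (z * q))^-1 * y = ([~ x, z] ^ q)^-1 * r)%g.
  by rewrite /r commgEl conjMg conjVg -conjgM (invgM (x ^ q)^-1%g) invgK -mulgA mulKVg.
have cqK := sub_conj q c4; have cqV := sub_inv cqK.
rewrite E; split; first exact: sub_mul.
apply/eqP; rewrite -subr_eq0; apply/eqP.
rewrite coord1M// coord2M// coord1V// coord2V// coord1J// coord2J// c5 c6 z4.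
transitivity (L r - L r / (A * coord2 1 x + B * coord1 1 x) * (A * coord2 1 x + B * coord1 1 x)).
  by rewrite /L; ring.
by rewrite mulfVK// subrr.
Qed.

Let cross x y := coord1 1 x * coord2 1 y - coord2 1 x * coord1 1 y.

(** The nonzero elements of F_3 are 1 and -1. *)
Lemma F3_eq (a b : 'F_p) : p = 3%N -> a != 0 -> b != 0 -> a + b != 0 -> a = b.
Proof.
move=> p3; have three0 : 3%:R = 0 :> 'F_p by apply/eqP; rewrite natFp_eq0// p3.
have cases (c : 'F_p) : c != 0 -> c = 1 \/ c = -1.
  have [n ->] := natFp_surj c; rewrite (divn_eq n 3) natrD natrM three0 mulr0 add0r.
  case: (n %% 3)%N (ltn_pmod n (isT : 0 < 3)%N) => [|[|[|//]]] _; rewrite ?eqxx//; first by left.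
  by move=> _; right; apply: (addIr 1); rewrite natr1 three0 addNr.
by move=> /cases[]-> /cases[]->; rewrite ?addNr ?subrr ?eqxx.
Qed.

Section LineOfSlope.
Variables A B : 'F_p.
Hypotheses (A0 : A != 0) (B0 : B != 0) (p3 : p = 3%N) (k1 : k = 1%N).
Hypothesis WE : forall f, W f <-> nott_sub K f /\ A * coord2 K f = B * coord1 K f.
(** Vanishes exactly on the slope [- B/A] opposite to that of W. *)
Let L x := A * coord2 1 x + B * coord1 1 x.

Lemma good_not_apart x y : L x != 0 -> L y != 0 -> cross x y = 0 ->
  ~ apart diamond_fin_normal x y.
Proof.
move=> Lx Ly /eqP; rewrite subr_eq0 => /eqP xy ap.
have [j jE] := natFp_surj (L x / L y).
have [||| g Wg] := @conj_class_mod A B (y ^+ j)%g x p3 k1 WE.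
- rewrite psi1X -jE; apply: (mulIf Ly); rewrite -mulrA mulfVK// /L.
  transitivity (A * (coord2 1 x * coord1 1 y) + B * (coord1 1 x * coord1 1 y)); first by ring.
  by rewrite -xy; ring.
- rewrite psi2X -jE; apply: (mulIf Ly); rewrite -mulrA mulfVK// /L.
  transitivity (A * (coord2 1 x * coord2 1 y) + B * (coord1 1 x * coord2 1 y)); first by ring.
  by rewrite xy; ring.
- rewrite psi1X psi2X -jE (_ : _ + _ = L y * (L x / L y)); last by rewrite /L; ring.
  by rewrite mulrCA divff// mulr1.
have Wx : W x.
  have := ap 1%N j g; rewrite expg1; apply.
  by have := WV Wg; rewrite (invgM ((y ^+ j) ^ g)^-1%g) invgK.
have x3 : agree 3 x 1%g.
  by apply/sub_agree/(sub_le _ (diamond_top Wx)); rewrite /K k1 p3.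
by move: Lx; rewrite /L (coord1_agree _ x3)// (coord2_agree _ x3)// coord1_one// coord2_one !mulr0 addr0 eqxx.
Qed.

Lemma bad_not_apart x y : L x = 0 -> L y = 0 ->
  (coord1 1 x != 0) || (coord2 1 x != 0) -> (coord1 1 y != 0) || (coord2 1 y != 0) ->
  ~ apart diamond_fin_normal x y.
Proof.
have z1 : (zdist p 1 - 1)%N = K by rewrite zdistS zdist0 /K k1; lia.
have n2 : 2%:R != 0 :> 'F_p by apply: natFp_neq0.
have power z : L z = 0 -> (coord1 1 z != 0) || (coord2 1 z != 0) ->
    nott_sub K (z ^+ p)%g /\ ~ W (z ^+ p)%g.
  move=> /eqP; rewrite /L addr_eq0 => /eqP Lz zn.
  have za : coord1 1 z != 0.
    apply: contraTneq zn => a0; move: Lz; rewrite a0 mulr0 oppr0 => /eqP.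
    by rewrite mulf_eq0 (negPf A0) /= => /eqP ->; rewrite eqxx.
  have zb : coord2 1 z != 0.
    apply: contraNneq za => b0; move: Lz; rewrite b0 mulr0 => /eqP.
    by rewrite eq_sym oppr_eq0 mulf_eq0 (negPf B0).
  have [zK c0 cs] := slope_exp_p p_pr p_odd 1 za zb; rewrite z1 expn1 in zK c0 cs.
  split=> // /WE[_ E].
  have : 2%:R * (B * coord1 1 z * coord1 K (z ^+ p)%g) = 0.
    transitivity (coord1 1 z * (B * coord1 K (z ^+ p)%g) - (- (B * coord1 1 z)) * coord1 K (z ^+ p)%g).
      by ring.
    rewrite -E -Lz; transitivity (A * (coord1 1 z * coord2 K (z ^+ p)%g - coord1 K (z ^+ p)%g * coord2 1 z)).
      by ring.
    by rewrite cs subrr mulr0.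
  by move/eqP; apply/negP; rewrite !mulf_neq0.
move=> Lx Ly xn yn ap; have [xK xW] := power x Lx xn; have [yK yW] := power y Ly yn.
have [i Wi] := diamond_cyclic xK yK yW.
by apply: xW; apply: (ap p (p * i)%N 1%g); rewrite conjg1 expgnA.
Qed.

Lemma triple_nonzero x y z : frattini_indep x y -> z \in [:: x; y; x * y]%g ->
  (coord1 1 z != 0) || (coord2 1 z != 0).
Proof.
rewrite /frattini_indep => xy zz; apply: contraNT xy; rewrite negb_or !negbK.
move: zz; rewrite !inE => /or3P[]/eqP -> /andP[/eqP E1 /eqP E2].
- by rewrite E1 E2 !mul0r.
- by rewrite E1 E2 !mulr0.
move: E1 E2; rewrite psi1M psi2M => /eqP; rewrite addr_eq0 => /eqP -> /eqP.
by rewrite addr_eq0 => /eqP ->; apply/eqP; ring.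
Qed.

Lemma triple_good x y : frattini_indep x y ->
  exists2 z, z \in [:: x; y; x * y]%g & L z != 0.
Proof.
move=> xy; have [Lx|Lx] := eqVneq (L x) 0; last by exists x; rewrite ?inE ?eqxx.
have [Ly|Ly] := eqVneq (L y) 0; last by exists y; rewrite ?inE ?eqxx ?orbT.
move: xy; rewrite /frattini_indep -subr_eq0 => /negP[]; apply/eqP/(mulfI A0); rewrite mulr0.
transitivity (coord1 1 x * L y - coord1 1 y * L x); first by rewrite /L; ring.
by rewrite Lx Ly !mulr0 subrr.
Qed.

(** If no member of the triple has the bad slope, the three members occupy the
    three other lines of the plane over F_3. *)
Lemma triple_parallel x y u : frattini_indep x y ->
  (forall z, z \in [:: x; y; x * y]%g -> L z != 0) -> L u != 0 ->
  exists2 z, z \in [:: x; y; x * y]%g & cross z u = 0.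
Proof.
move=> xy good Lu.
have [E|cx] := eqVneq (cross x u) 0; first by exists x; rewrite ?inE ?eqxx.
have [E|cy] := eqVneq (cross y u) 0; first by exists y; rewrite ?inE ?eqxx ?orbT.
have [E|cxy] := eqVneq (cross (x * y) u)%g 0.
  by exists (x * y)%g; rewrite ?inE ?eqxx ?orbT.
have Lxy : L x = L y.
  apply: F3_eq => //; try by apply: good; rewrite !inE eqxx ?orbT.
  have := good (x * y)%g; rewrite !inE eqxx !orbT => /(_ isT).
  by rewrite /L psi1M psi2M; congr (_ != 0); ring.
have cxu : cross x u = cross y u.
  by apply: F3_eq => //; apply: contraNneq cxy => E; rewrite -E /cross psi1M psi2M; apply/eqP; ring.
exfalso; move: Lu; apply/negP; rewrite negbK.
pose a := coord1 1 x - coord1 1 y; pose b := coord2 1 x - coord2 1 y.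
have Lw : A * b + B * a = 0 by rewrite -[RHS](subrr (L x)) {2}Lxy /L /a /b; ring.
have cw : a * coord2 1 u - b * coord1 1 u = 0.
  by rewrite -[RHS](subrr (cross x u)) {2}cxu /cross /a /b; ring.
have [a0|a0] := eqVneq a 0.
  have [b0|b0] := eqVneq b 0.
    move: xy; rewrite /frattini_indep; move/eqP: a0; rewrite subr_eq0 => /eqP ->.
    by move/eqP: b0; rewrite subr_eq0 => /eqP ->; rewrite mulrC eqxx.
  apply/eqP/(mulIf b0); rewrite mul0r.
  transitivity (coord2 1 u * (A * b + B * a) - B * (a * coord2 1 u - b * coord1 1 u)).
    by rewrite /L; ring.
  by rewrite Lw cw !mulr0 subrr.
apply/eqP/(mulIf a0); rewrite mul0r.
transitivity (coord1 1 u * (A * b + B * a) + A * (a * coord2 1 u - b * coord1 1 u)).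
  by rewrite /L; ring.
by rewrite Lw cw !mulr0 addr0.
Qed.

Lemma not_beauville_3_1 : ~ is_beauville [set: diamond_quot p_pr gW ltW Wlt]%G.
Proof.
have k0 : (0 < k)%N by rewrite k1.
move=> /is_beauville_diamondP[x1 [y1 [x2 [y2]]]].
move=> -[/(generate_indep _ _ k0) g1 /(generate_indep _ _ k0) g2 ap].
have bad_or_good x y : (exists2 z, z \in [:: x; y; x * y]%g & L z = 0) \/
    (forall z, z \in [:: x; y; x * y]%g -> L z != 0).
  have [z0|no] := pselect (exists2 z, z \in [:: x; y; x * y]%g & L z = 0); first by left.
  by right=> z zz; apply/eqP => E; apply: no; exists z.
case: (bad_or_good x1 y1) => [[x xx Lx]|good1]; last first.
  have [y yy Ly] := triple_good g2; have [x xx xy] := triple_parallel g1 good1 Ly.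
  exact: good_not_apart (good1 x xx) Ly xy (ap _ _ xx yy).
case: (bad_or_good x2 y2) => [[y yy Ly]|good2].
  by apply: (bad_not_apart Lx Ly (triple_nonzero g1 xx) (triple_nonzero g2 yy)); exact: ap.
have [z zz Lz] := triple_good g1; have [y yy yz] := triple_parallel g2 good2 Lz.
apply: (good_not_apart Lz (good2 y yy) _ (ap _ _ zz yy)).
by move: yz; rewrite /cross => /eqP; rewrite subr_eq0 => /eqP yz; apply/eqP; rewrite subr_eq0; apply/eqP; rewrite mulrC -yz mulrC.
Qed.

End LineOfSlope.

End Diamond.

Local Open Scope nat_scope.
Local Open Scope classical_set_scope.

Theorem theorem3p11 (p k : nat) (W : set (nottingham p))
    (p_pr : prime p) (p_odd : odd p)
    (gW : is_subgroup W)
    (ltW : nott_sub (k * p + 3) `<` W)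
    (Wlt : W `<` nott_sub (k * p + 1)) :
  let NW := diamond_quot p_pr gW ltW Wlt in
  (~ distinguished p k -> is_beauville [set: NW]%G) /\
  (forall m : nat, diamond_at p k m ->
    (is_beauville [set: NW]%G <->
       [/\ (3 < p -> 1 <= m), (p = 3 -> 2 <= m),
           W <> nott_sub (zdist p m)
         & W <> gen_subgroup ([set special_elt p m] `|` nott_sub (zdist p m + 1))])).
Proof.
move=> NW; have p_gt2 := odd_prime_gt2 p_odd p_pr.
have atE l : zdist p l - 1 = k * p + 1 -> diamond_at p k l.
  by move=> E; have := zdist_gt0 p l; split; lia.
have k0E : k = 0 -> diamond_at p k 0 by move=> k0; apply: atE; rewrite zdist0 k0.
split=> [nd|m [mK _]].
  have k0 : 0 < k by rewrite lt0n; apply/eqP => /k0E E; apply: nd; exists 0.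
  have sW l f : zdist p l - 1 = k * p + 1 -> nott_sub (k * p + 1) f ->
      coord2 (k * p + 1) f = (1 * coord1 (k * p + 1) f)%R -> W f.
    by move=> /atE E; case: nd; exists l.
  have [p3|p3] := eqVneq p 3; last by apply: beauville_gt3 sW; rewrite ?oner_neq0//; lia.
  apply: beauville_3 sW; rewrite ?oner_neq0// ltnNge; apply/negP => k1.
  apply: nd; exists 1; apply: atE; rewrite zdistS zdist0 p3; lia.
have [A [B [AB WE]]] := diamond_line p_pr p_odd gW ltW Wlt.
have K0 : 0 < k * p + 1 by rewrite addn1.
have zK : zdist p m = (k * p + 1).+1 by have := zdist_gt0 p m; lia.
have m0E : m = 0 -> k = 0.
  by move=> m0; move: mK; rewrite m0 zdist0; have := prime_gt0 p_pr; nia.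
have K1 : 0 < k -> 1 < k * p + 1 by nia.
have A0 : W <> nott_sub (zdist p m) -> A != 0%R.
  move=> ne; apply: contra_notN ne => /eqP A0; move: AB; rewrite A0 eqxx /= => B0.
  apply/predeqP => f; rewrite WE (nott_sub_zdist zK _ K0) A0 mul0r.
  split=> -[fK f1]; split=> //; last by rewrite f1 mulr0.
  by apply: (mulfI B0); rewrite mulr0.
have B0 : 0 < k -> W <> gen_subgroup ([set special_elt p m] `|` nott_sub (zdist p m + 1)) ->
    B != 0%R.
  move=> k0 ne; apply: contra_notN ne => /eqP B0; move: AB; rewrite B0 eqxx orbF => A1.
  apply/predeqP => f; rewrite WE (gen_special zK _ p_pr (K1 k0)).
  rewrite B0 mul0r; split=> -[fK f1]; split=> //; last by rewrite f1 mulr0.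
  by apply: (mulfI A1); rewrite mulr0.
split=> [beau|[m1 m2 neq1 neq2]].
  have m0 : 0 < m.
    by rewrite lt0n; apply/eqP => /m0E k0; apply: not_beauville_first beau.
  have k0 : 0 < k.
    rewrite lt0n; apply/eqP => k0; move: m0.
    by rewrite (@zdist_inj p p_pr m 0)//; have := zdist_gt0 p m; rewrite zdist0; lia.
  have neq1 : W <> nott_sub (zdist p m).
    move=> WE1; apply: (not_beauville_axis p_odd k0 (esym mK) _ beau) => f.
    by rewrite WE1 => /(nott_sub_zdist zK _ K0)[]; left.
  have neq2 : W <> gen_subgroup ([set special_elt p m] `|` nott_sub (zdist p m + 1)).
    move=> WE2; apply: (not_beauville_axis p_odd k0 (esym mK) _ beau) => f.
    by rewrite WE2 => /(gen_special zK _ p_pr (K1 k0))[]; right.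
  split=> // p3; rewrite ltn_neqAle m0 andbT; apply/eqP => m1.
  have k1 : k = 1.
    by move: mK; rewrite -m1 zdistS zdist0 p3; lia.
  by apply: (not_beauville_3_1 p_odd (A0 neq1) (B0 k0 neq2) p3 k1 WE) beau.
have m0 : 0 < m.
  by have [/m2|p3] := eqVneq p 3; [lia | apply: m1; lia].
have k0 : 0 < k.
  rewrite lt0n; apply/eqP => k0; move: m0.
  by rewrite (@zdist_inj p p_pr m 0)//; have := zdist_gt0 p m; rewrite zdist0; lia.
have {}A0 := A0 neq1; have {}B0 := B0 k0 neq2.
have s0 : (B / A != 0)%R by rewrite mulf_neq0 ?invr_eq0.
have sW (l : nat) f : zdist p l - 1 = k * p + 1 -> nott_sub (k * p + 1) f ->
    coord2 (k * p + 1) f = (B / A * coord1 (k * p + 1) f)%R -> W f.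
  by move=> _ fK f1; apply/WE; split=> //; rewrite f1 mulrA mulrCA divff// mulr1.
have [p3|p3] := eqVneq p 3; last by apply: beauville_gt3 s0 sW; rewrite //; lia.
apply: beauville_3 s0 sW => //.
move: mK; have := m2 p3; case: (m) => [//|[//|n]] _.
by rewrite !zdistS p3; have := zdist_gt0 3 n; lia.
Qed.
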